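(* Let $p$ be a prime and let $G$ be a transitive permutation group of degree $p^2$ with Sylow $p$-subgroup $P$. Then at least one of the following holds: (1) $G$ is doubly transitive; or (2) $P \triangleleft G$; or (3) $P$ is equivalent to either $\mathbb{Z}_p\times\mathbb{Z}_p$, $P_{p-1}'$, or $\mathbb{Z}_p\wr\mathbb{Z}_p$.
   Context: Two permutation groups of degree $p^2$ are equivalent if they are permutation isomorphic, i.e. conjugate in $S_{p^2}$ after identifying the underlying sets. Take the underlying set to be $\mathbb{Z}_p\times\mathbb{Z}_p$. As permutation groups of degree $p^2$: $\mathbb{Z}_p\times\mathbb{Z}_p$ denotes the regular group of translations $\langle\rho_1,\rho_2\rangle$, where $\rho_1(i,j)=(i,j+1)$ and $\rho_2(i,j)=(i+1,j)$. $\mathbb{Z}_p\wr\mathbb{Z}_p$ denotes the imprimitive wreath product $\langle \rho_2, z_0,\dots,z_{p-1}\rangle$ of order $p^{p+1}$, where $z_i$ maps $(i,j)$ to $(i,j+1)$ and fixes every $(i',j)$ with $i'\ne i$ (this is a Sylow $p$-subgroup of $S_{p^2}$). $P_{p-1}'$ denotes the unique (up to conjugacy) $p$-subgroup of $S_{p^2}$ of order $p^p$ containing a transitive subgroup isomorphic to $\mathbb{Z}_p\times\mathbb{Z}_p$. Explicitly, $P_{p-1}'=\langle\rho_1,\rho_2,z_0^{-1}z_1\rangle$. *)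

(* Defs.v *)
From mathcomp Require Import all_boot all_algebra all_fingroup all_solvable.

Set Implicit Arguments.
Unset Strict Implicit.
Unset Printing Implicit Defensive.

Import GroupScope.

(* Conjugacy of permutation groups after identifying the underlying sets: for
   some bijection f : T -> U, B = { f o t o f^-1 | t in A }. *)
Definition perm_equivalent (T U : finType)
    (A : {set {perm T}}) (B : {set {perm U}}) : Prop :=
  exists2 f : T -> U, bijective f &
    forall s : {perm U},
      s \in B <-> exists2 t : {perm T}, t \in A & forall x, s (f x) = f (t x).

(* 'Z_p is Z/pZ only for p > 1; the definitions below are used for p prime. *)
Section DegreePSquared.

Variable p : nat.

Definition Zp2 : finType := ('Z_p * 'Z_p)%type.

Definition rho1_fun (x : Zp2) : Zp2 := (x.1, (x.2 + 1)%R).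
Definition rho2_fun (x : Zp2) : Zp2 := ((x.1 + 1)%R, x.2).
Definition z_fun (i : 'Z_p) (x : Zp2) : Zp2 :=
  if x.1 == i then (x.1, (x.2 + 1)%R) else x.

Lemma rho1_inj : injective rho1_fun.
Proof.
move=> [a b] [c d] /eqP; rewrite xpair_eqE /=.
by case/andP=> /eqP-> /eqP/GRing.addIr->.
Qed.

Lemma rho2_inj : injective rho2_fun.
Proof.
move=> [a b] [c d] /eqP; rewrite xpair_eqE /=.
by case/andP=> /eqP/GRing.addIr-> /eqP->.
Qed.

Lemma z_inj (i : 'Z_p) : injective (z_fun i).
Proof.
move=> [a b] [c d]; rewrite /z_fun /=.
case: (eqVneq a i) => ai; case: (eqVneq c i) => ci //;
  move/eqP; rewrite xpair_eqE /= => /andP[/eqP ac].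
- by move/eqP/GRing.addIr->; rewrite ac.
- by rewrite -ac ai eqxx in ci.
- by rewrite ac ci eqxx in ai.
Qed.

Definition rho1 : {perm Zp2} := perm rho1_inj.
Definition rho2 : {perm Zp2} := perm rho2_inj.
Definition zperm (i : 'Z_p) : {perm Zp2} := perm (@z_inj i).

Definition Zp_times_Zp : {group {perm Zp2}} := [group of <<[set rho1; rho2]>>].

(* The group P_{p-1}', of order p ^ p. *)
Definition P_pred_p' : {group {perm Zp2}} :=
  [group of <<[set rho1; rho2; (zperm 0%R)^-1 * zperm 1%R]>>].

Definition Zp_wr_Zp : {group {perm Zp2}} :=
  [group of <<rho2 |: [set zperm i | i : 'Z_p]>>].

End DegreePSquared.

(* Main.v *)
(* Identify the points with F_p x F_p so that P lies in the wreath product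
   {(x, y) |-> (x + a, y + f x)} and, when G is imprimitive, the columns {x} x F_p
   are blocks.  The vertical translations y |-> y + f x contained in P are those
   with deg f < n for some 1 <= n <= p, and P is generated by them and some
   (x, y) |-> (x + 1, y + h x); put s = sum_x h x.  If n = p, or if s = 0 and n is
   1 or p - 1, then P is one of the three listed groups.

   G primitive.  If n >= 2, the stabiliser of a point is transitive on every
   other column; if s <> 0, P contains a regular cyclic group and Schur's
   argument (the p-th power of the adjacency matrix of an orbital, computed in
   characteristic p) shows that it is still transitive on every other column.  A
   column is thus a module of the colouring of pairs by orbitals, and a primitive
   group with such a module is doubly transitive.

   G imprimitive.  Let K be the kernel on the set of columns and Q the group of
   vertical translations in P, a Sylow subgroup of K.  If Q is normal in G, then g
   acts on Q by f |-> c * (f \o sg), and comparing degrees shows that c is constant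
   and that sg is affine unless n is 1 or p - 1.  If all the sg are affine, P is
   normal at once; and if s <> 0, the sum of the vertical displacements is a
   homomorphism on the centraliser of (x, y) |-> (x, y + 1) whose kernel lies in P.
   If Q is not normal, either n = p, or K acts faithfully on every column; in the
   latter case the result applied to the normaliser of Q shows that Q is
   self-normalising in K, and counting elements with a fixed point gives K = Q. *)

Require Import Defs.
From mathcomp Require Import all_boot all_algebra all_fingroup all_solvable.
From mathcomp Require Import all_field.
Import GroupScope.

Set Implicit Arguments.
Unset Strict Implicit.
Unset Printing Implicit Defensive.

Import GRing.Theory.

(** * Polynomial functions on the prime field *)

Section PolynomialFunctions.
Variable p : nat.
Hypothesis hp : prime p.
Local Notation F := 'F_p.
Local Open Scope ring_scope.

Lemma poly_fun_inj (q r : {poly F}) :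
  (size q <= p)%N -> (size r <= p)%N -> (forall x, q.[x] = r.[x]) -> q = r.
Proof.
move=> sq sr qr; apply/eqP; rewrite -subr_eq0; apply/eqP.
apply: (@roots_geq_poly_eq0 _ _ (enum F)).
- by apply/allP=> x _; rewrite rootE !hornerE qr subrr.
- exact: enum_uniq.
rewrite -cardE card_Fp //; apply: leq_trans (size_polyD _ _) _.
by rewrite size_polyN geq_max sq.
Qed.

Lemma predp_eq0 : (p.-1 == 0)%N = false.
Proof. by apply: negbTE; rewrite -lt0n -subn1 subn_gt0 prime_gt1. Qed.

(** By Fermat's little theorem [1 - ('X - a%:P) ^+ p.-1] is the indicator function of [a]. Below,
    [size (interp f)] measures the degree of a function [f] on the prime field. *)
Definition interp (f : F -> F) : {poly F} :=
  \sum_a f a *: (1 - ('X - a%:P) ^+ p.-1).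

Lemma size_interp_term (a : F) : (size (1 - ('X - a%:P) ^+ p.-1)%R <= p)%N.
Proof.
apply: leq_trans (size_polyD _ _) _.
by rewrite size_polyN size_exp_XsubC size_poly1 geq_max prednK ?leqnn prime_gt0.
Qed.

Lemma size_interp f : (size (interp f) <= p)%N.
Proof.
apply: (big_ind (fun q : {poly F} => (size q <= p)%N)) => [|q r sq sr|a _].
- by rewrite size_poly0.
- by apply: leq_trans (size_polyD _ _) _; rewrite geq_max sq.
by apply: leq_trans (size_scale_leq _ _) (size_interp_term a).
Qed.

Lemma fermat_Fp (x : F) : x != 0 -> x ^+ p.-1 = 1.
Proof.
move=> x0; apply: (mulfI x0); rewrite mulr1 -exprS prednK ?prime_gt0 //.
by rewrite -[X in x ^+ X](card_Fp hp) expf_card.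
Qed.

Lemma horner_interp f x : (interp f).[x] = f x.
Proof.
rewrite /interp horner_sum (bigD1 x) //= big1 => [|a ax].
  by rewrite !hornerE subrr expr0n predp_eq0 subr0 mulr1 ?addr0.
by rewrite !hornerE fermat_Fp ?subrr ?mulr0 // subr_eq0 eq_sym.
Qed.

Lemma interp_horner (q : {poly F}) : (size q <= p)%N -> interp (horner q) = q.
Proof.
by move=> sq; apply: poly_fun_inj; rewrite ?size_interp // => x; rewrite horner_interp.
Qed.

(** Each indicator polynomial has coefficient -1 at degree [p.-1], so the top coefficient of the
    interpolant records the sum of the values. *)
Lemma sum_horner (q : {poly F}) : (size q <= p)%N -> \sum_x q.[x] = - q`_p.-1.
Proof.
move=> sq; rewrite -{2}(interp_horner sq) /interp coef_sum -sumrN.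
apply: eq_bigr => a _; rewrite coefZ coefB coef1.
have ->: (('X - a%:P) ^+ p.-1)`_p.-1 = 1.
  have := monic_exp p.-1 (monicXsubC a).
  by rewrite monicE lead_coefE size_exp_XsubC => /eqP.
by rewrite predp_eq0 sub0r mulrN1 opprK.
Qed.

Lemma sum_horner_small (q : {poly F}) : (size q < p)%N -> \sum_x q.[x] = 0.
Proof.
move=> sq; rewrite sum_horner 1?ltnW // nth_default ?oppr0 //.
by rewrite -ltnS prednK // prime_gt0.
Qed.

Lemma sum_horner_full (q : {poly F}) :
  (size q <= p)%N -> \sum_x q.[x] = 0 -> (size q < p)%N.
Proof.
move=> sq; rewrite sum_horner // => /eqP; rewrite oppr_eq0 => /eqP q0.
rewrite ltn_neqAle sq andbT; apply/eqP=> sqp.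
have: lead_coef q == 0 by rewrite lead_coefE sqp q0.
by rewrite lead_coef_eq0 => /eqP q00; move: sqp hp; rewrite q00 size_poly0 => <-.
Qed.

Lemma natrF (x : F) : (val x)%:R = x.
Proof. exact: natr_Zp. Qed.

Lemma natrF_neq0 n : (0 < n < p)%N -> n%:R != 0 :> F.
Proof.
case/andP=> n0 np; have := pchar_Fp hp => /dvdn_pcharf <-.
by rewrite gtnNdvd.
Qed.



Lemma coef_X1_exp n k : (('X + 1 : {poly F}) ^+ n)`_k = 'C(n, k)%:R.
Proof.
have -> : ('X + 1 : {poly F}) ^+ n = \poly_(i < n.+1) 'C(n, i)%:R.
  by rewrite exprD1n poly_def; apply: eq_bigr => i _; rewrite scaler_nat.
by rewrite coef_poly; case: ltnP => // nk; rewrite bin_small.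
Qed.

(** If the leading term has degree d > 0, the difference has d times the leading coefficient at
    degree d - 1, which is nonzero since d < p. *)
Lemma size_diff (q : {poly F}) : (size q <= p)%N ->
  size (q \Po ('X + 1) - q)%R = (size q).-1.
Proof.
move=> sq; have [s1|s1] := leqP (size q) 1.
  rewrite (size1_polyC s1) comp_polyC subrr size_poly0 size_polyC.
  by case: (_ != 0).
case sqE: (size q) s1 => [|[|n]] // _ in sq *.
have top k : (n < k)%N -> (q \Po ('X + 1) - q)`_k = 0.
  move=> nk; rewrite coefB coef_comp_poly sqE big_ord_recr big1 => [|i _] /=.
    rewrite add0r coef_X1_exp; move: nk; rewrite leq_eqVlt => /orP[/eqP<-|nk].
      by rewrite binn mulr1 subrr.
    by rewrite bin_small // mulr0 nth_default ?subrr // sqE.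
  by rewrite coef_X1_exp bin_small ?mulr0 // (leq_trans (ltn_ord i)).
apply/eqP; rewrite eqn_leq /=; apply/andP; split; first exact/leq_sizeP.
rewrite ltnNge; apply/negP=> /leq_sizeP/(_ n (leqnn n)).
rewrite coefB coef_comp_poly sqE !big_ord_recr big1 => [|i _] /=.
  rewrite add0r !coef_X1_exp binn mulr1 addrAC subrr add0r binSn.
  apply/eqP; rewrite mulf_eq0 negb_or natrF_neq0 // andbT.
  by have := lead_coef_eq0 q; rewrite lead_coefE sqE /= => ->;
     rewrite -size_poly_gt0 sqE.
by rewrite coef_X1_exp bin_small ?mulr0.
Qed.

(** Over a prime field additivity gives closure under scalars. Differencing [q] lowers its size by
    one, so induction yields all smaller polynomials, and a multiple of [q] supplies the leading
    term. *)
Lemma shift_invariant_mem (V : {poly F} -> Prop) :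
    (forall q r, V q -> V r -> V (q + r)) ->
    (forall q, V q -> V (q \Po ('X + 1))) ->
  forall q r : {poly F}, (size q <= p)%N -> V q -> (size r <= size q)%N -> V r.
Proof.
move=> VD VX q r; have [n] := ubnP (size q).
have VZ (a : F) u : V u -> V (a *: u).
  move=> Vu; have V0 : V 0.
    have -> : 0 = u *+ p :> {poly F}.
      by rewrite -scaler_nat pchar_Fp_0 // scale0r.
    have Vm m : V (u *+ m.+1) by elim: m => // m IH; rewrite mulrS; apply: VD.
    by have := Vm p.-1; rewrite prednK ?prime_gt0.
  rewrite -(natrF a) scaler_nat; elim: (val a) => [|m IH]; first by rewrite mulr0n.
  by rewrite mulrS; apply: VD.
have VB u v : V u -> V v -> V (u - v).
  by move=> Vu Vv; apply: VD => //; rewrite -scaleN1r; apply: VZ.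
elim: n q r => // n IH q r; rewrite ltnS => qn qp Vq rq.
have Vd (r0 : {poly F}) : (size r0 < size q)%N -> V r0.
  move=> uq; have q0: (0 < size q)%N by apply: leq_ltn_trans uq.
  have szd := size_diff qp.
  apply: (IH (q \Po ('X + 1) - q)) => [|||]; rewrite ?szd.
  - by rewrite -ltnS prednK.
  - exact: leq_trans (leq_pred _) qp.
  - by apply: VB => //; apply: VX.
  by rewrite -ltnS prednK.
have [q0|q0] := eqVneq q 0.
  by move: rq Vq; rewrite q0 size_poly0 leqn0 size_poly_eq0 => /eqP->.
pose a := r`_(size q).-1 / lead_coef q.
rewrite -[r](subrK (a *: q)); apply: VD; last exact: VZ.
apply: Vd; have sq0: (0 < size q)%N by rewrite size_poly_gt0.
rewrite -[X in (_ < X)%N](prednK sq0) ltnS; apply/leq_sizeP=> j.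
rewrite leq_eqVlt => /orP[/eqP<-|].
  by rewrite coefB coefZ /a lead_coefE divfK ?subrr // -lead_coefE lead_coef_eq0.
rewrite prednK // => qj; rewrite coefB coefZ !nth_default ?mulr0 ?subrr //.
exact: leq_trans qj.
Qed.


(* Elements of the group act by conjugation on the vertical translations as such
   weighted substitutions [q |-> c * (q \o sg)], see [vtrans_conj]. *)
Definition substitution_stable n (c sg : F -> F) :=
  forall q : {poly F}, (size q <= n)%N ->
  exists2 q' : {poly F}, (size q' <= n)%N & forall x, q'.[x] = c x * q.[sg x].

(* Functions of degree [< n] and of degree [< p - n] annihilate each other
   under the pairing [sum_x f x * g x]. *)
Lemma substitution_stable_dual n (c sg : F -> F) : (n <= p)%N ->
  (forall x, c x != 0) -> injective sg ->
  (forall q : {poly F}, (size q <= n)%N ->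
    exists2 q' : {poly F}, (size q' <= n)%N & forall x, q.[x] = c x * q'.[sg x]) ->
  substitution_stable (p - n) (fun x => (c x)^-1) sg.
Proof.
move=> np c0 sgI stab q sq; pose f x := (c x)^-1 * q.[sg x].
exists (interp f) => [|x]; last by rewrite horner_interp.
set r := interp f; have sr : (size r <= p)%N by apply: size_interp.
rewrite leqNgt; apply/negP=> rn.
have r0 : r != 0 by rewrite -size_poly_gt0 (leq_ltn_trans _ rn).
have sr0 : (0 < size r)%N by rewrite size_poly_gt0.
(* Multiplied by this monomial, [r] gets degree exactly [p.-1], so the values of the product cannot
   sum to 0; yet their sum is also that of [q * u], of smaller degree. *)
have sX : (size ('X^(p - size r) : {poly F}) <= n)%N.
  by rewrite size_polyXn ltn_subLR // addnC -ltn_subLR.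
have [u su uE] := stab _ sX.
have srX : size (r * 'X^(p - size r)) = p.
  by rewrite size_mul // -?size_poly_gt0 size_polyXn // addnS /= addnC subnK.
have : \sum_x (r * 'X^(p - size r)).[x] = 0.
  transitivity (\sum_x (q * u).[sg x]).
    apply: eq_bigr => x _; rewrite !hornerM uE horner_interp /f.
    by rewrite mulrACA mulVf // mul1r.
  rewrite -[RHS](_ : \sum_x (q * u).[x] = 0).
    by rewrite [RHS](reindex_inj sgI).
  apply: sum_horner_small; have [->|q0] := eqVneq q 0.
    by rewrite mul0r size_poly0 prime_gt0.
  have [->|u0] := eqVneq u 0; first by rewrite mulr0 size_poly0 prime_gt0.
  rewrite size_mul // -subn1 ltn_subLR ?addn_gt0 ?size_poly_gt0 ?q0 // add1n ltnS.
  by apply: leq_trans (leq_add sq su) _; rewrite subnK.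
by move/sum_horner_full; rewrite srX ltnn => /(_ (leqnn _)).
Qed.

Lemma nonroot_size2 (q : {poly F}) :
  (size q <= 2)%N -> (forall x, q.[x] != 0) -> size q = 1.
Proof.
move=> sq q0; case: (ltngtP (size q) 1) => // [|s1].
  by rewrite ltnS leqn0 size_poly_eq0 => /eqP qE; have := q0 0; rewrite qE horner0 eqxx.
have /eqP/poly2_root[x /eqP qx] : size q == 2 by rewrite eqn_leq sq.
by have := q0 x; rewrite qx eqxx.
Qed.

(* The polynomials [w_j] of degree [<= d := n - 1] representing [c * sg ^ j] satisfy
   [w_1 ^ d = w_d * w_0 ^ (d - 1)], as all degrees stay below [p]. Therefore
   [(w_0 / g) ^ (d - 1)] divides [g := gcd w_0 w_1], which forces [w_0 / g] to have
   degree at most 1, hence to be constant as it has no root. *)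
Lemma substitution_stable_affine n (c sg : F -> F) :
    (1 < n)%N -> (2 * n <= p)%N -> (forall x, c x != 0) -> injective sg ->
    substitution_stable n c sg ->
  (exists a, forall x, c x = a) /\ exists a b, forall x, sg x = a * x + b.
Proof.
case: n => [|d] // d0 dp c0 sgI stab; rewrite ltnS in d0.
have wE j : exists w : {poly F}, (j <= d)%N ->
    (size w <= d.+1)%N /\ forall x, w.[x] = c x * sg x ^+ j.
  case: (leqP j d) => [jd|]; last by exists 0.
  have [|w sw wE] := stab 'X^j; first by rewrite size_polyXn.
  by exists w => _; split=> // x; rewrite wE hornerXn.
have [w0 /(_ isT)[sw0 w0E]] := wE 0%N.
have [w1 /(_ d0)[sw1 w1E]] := wE 1%N.
have w00 : w0 != 0.
  by apply: contraNneq (c0 0) => w00; rewrite -[c 0]mulr1 -(w0E 0) w00 horner0.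
have powE j : (0 < j <= d)%N -> exists2 w : {poly F}, (size w <= d.+1)%N &
    w1 ^+ j = w * w0 ^+ j.-1 /\ forall x, w.[x] = c x * sg x ^+ j.
  elim: j => // -[_ _|j IH /andP[_ jd]].
    by exists w1; rewrite ?expr1 ?expr0 ?mulr1.
  have [|w sw [wpow wE']] := IH; first exact: ltnW.
  have [v /(_ jd)[sv vE]] := wE j.+2; exists v; rewrite // exprSr wpow; split=> //.
  have -> : w * w0 ^+ j.+1.-1 * w1 = (w * w1) * w0 ^+ j by rewrite /= mulrAC.
  rewrite /= exprS mulrA; congr (_ * _).
  have small (a b : {poly F}) : (size a <= d.+1)%N -> (size b <= d.+1)%N ->
      (size (a * b)%R <= p)%N.
    move=> sa sb; apply: leq_trans (size_polyMleq _ _) _.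
    apply: leq_trans (leq_pred _) _; apply: leq_trans dp.
    by rewrite mul2n -addnn leq_add.
  apply: poly_fun_inj; rewrite ?small // => x.
  by rewrite !hornerM wE' w1E vE w0E expr1 expr0 mulr1 mulrACA -exprSr mulrAC.
have [|w sw [wpow _]] := powE d; first by rewrite d0 /=.
set g := gcdp w0 w1; pose c' := w0 %/ g; pose u' := w1 %/ g.
have g0 : g != 0 by rewrite gcdp_eq0 (negPf w00).
have c'g : w0 = c' * g by rewrite divpK // dvdp_gcdl.
have u'g : w1 = u' * g by rewrite divpK // dvdp_gcdr.
have cop : coprimep c' u' by rewrite coprimep_div_gcd // w00.
have c'0 : c' != 0 by apply: contraNneq w00 => c'0; rewrite c'g c'0 mul0r.
have dE : d = d.-1.+1 by rewrite prednK.
have key : u' ^+ d * g = w * c' ^+ d.-1.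
  apply: (mulIf (expf_neq0 d.-1 g0)); rewrite -mulrA -exprS -dE -exprMn -u'g.
  by rewrite wpow c'g exprMn mulrA.
have dvg : c' ^+ d.-1 %| g.
  have cop2 : coprimep (c' ^+ d.-1) (u' ^+ d).
    by rewrite coprimep_expl ?coprimep_expr.
  by rewrite -(Gauss_dvdpr _ cop2) key dvdp_mulIr.
have szw0 : size w0 = ((size c').-1 + size g)%N.
  by rewrite c'g size_mul // -!subn1 addnC -addnBA ?size_poly_gt0 // addnC.
have szg : ((size c').-1 * d.-1 < size g)%N.
  apply: leq_trans (dvdp_leq g0 dvg).
  by rewrite -size_exp prednK // size_poly_gt0 expf_neq0.
have szc' : (size c' <= 2)%N.
  rewrite leqNgt; apply/negP=> sc.
  have : ((size c').-1 * d < d.+1)%N.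
    apply: leq_trans sw0; rewrite szw0 {1}dE mulnS -addnS leq_add2l.
    exact: szg.
  rewrite ltnNge; case/negP; case: (size c') sc => [|[|[|m]]] //= _.
  by rewrite mulSn -[X in (X < _)%N]addn0 ltn_add2l muln_gt0.
have c'1 : size c' = 1.
  apply: nonroot_size2 => // x; apply: contraNneq (c0 x) => c'x.
  by rewrite -[c x]mulr1 -(w0E x) c'g hornerM c'x mul0r.
have [a a0 c'a] := size_poly1P c' (introT eqP c'1).
have sgE x : sg x = a^-1 * u'.[x].
  have g0x : g.[x] != 0.
    apply: contraNneq (c0 x) => gx.
    by rewrite -[c x]mulr1 -(w0E x) c'g hornerM gx mulr0.
  apply: (mulfI (c0 x)); apply: (mulIf g0x).
  have := w1E x; have := w0E x; rewrite u'g c'g c'a !hornerM hornerC expr0 mulr1 expr1.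
  by move=> <- <-; rewrite [a * _]mulrC -!mulrA mulVKf // mulrCA.
have u'0 : u' != 0.
  apply/eqP=> u'0; have := oner_neq0 F; rewrite -(sgI 1 0) ?eqxx //.
  by rewrite !sgE u'0 !horner0.
have su' : (1 < size u')%N.
  rewrite ltnNge; apply/negP=> /size1_polyC u'E; have := oner_neq0 F.
  by rewrite -(sgI 1 0) ?eqxx // !sgE u'E !hornerC.
(* With [c'] constant, [u' ^+ d * g] is a scalar multiple of [w], of degree at most [d]. As [u'] is
   not constant, it has degree 1 and [g] is constant. *)
have sz : ((size u').-1 * d + size g <= d.+1)%N.
  have : size (u' ^+ d * g) = ((size u').-1 * d + size g)%N.
    rewrite size_mul ?expf_neq0 // -size_exp -!subn1 addnBAC //.
    by rewrite size_poly_gt0 expf_neq0.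
  rewrite key c'a -polyC_exp mulrC mul_polyC size_scale ?expf_neq0 // => <-.
  exact: sw.
have sg1 : (0 < size g)%N by rewrite size_poly_gt0.
have su2 : size u' = 2.
  apply/eqP; rewrite eqn_leq su' andbT leqNgt; apply/negP=> su3.
  have k2 : (2 <= (size u').-1)%N by rewrite -ltnS prednK // ltnW.
  have : (2 * d + 1 <= d.+1)%N.
    by apply: leq_trans sz; rewrite leq_add // leq_mul2r k2 orbT.
  by rewrite addn1 ltnS mul2n -addnn -{3}[d]addn0 leq_add2l leqNgt d0.
have g1 : size g = 1.
  by apply/eqP; rewrite eqn_leq sg1 andbT; move: sz; rewrite su2 mul1n -addn1 leq_add2l.
split.
  have [b _ gb] := size_poly1P g (introT eqP g1).
  exists (a * b) => x; have := w0E x.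
  by rewrite expr0 mulr1 => <-; rewrite c'g c'a gb -polyCM hornerC.
exists (a^-1 * u'`_1), (a^-1 * u'`_0) => x.
rewrite sgE horner_coef su2 !big_ord_recl big_ord0 /= addr0 expr0 expr1 mulr1.
by rewrite mulrDr mulrA addrC.
Qed.

Lemma substitution_stable_const (c sg : F -> F) :
  substitution_stable 1 c sg -> exists a, forall x, c x = a.
Proof.
move=> /(_ 1)[|q sq qE]; first by rewrite size_poly1.
exists q`_0 => x; have := qE x.
by rewrite (size1_polyC sq) !hornerC mulr1 coefC.
Qed.

(** One of [n] and [p - n] is at most half of [p], so the affine case applies to the given
    substitutions or to the dual ones, of weight [c^-1]. For [n = 1] or [n = p.-1] one of the two
    families consists of constants, whence the weight is constant. *)
Lemma substitution_stable_rigid n (c sg : F -> F) :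
    (0 < n < p)%N -> (forall x, c x != 0) -> injective sg ->
    substitution_stable n c sg ->
    (forall q : {poly F}, (size q <= n)%N ->
      exists2 q' : {poly F}, (size q' <= n)%N & forall x, q.[x] = c x * q'.[sg x]) ->
  (exists a, forall x, c x = a) /\
  (n = 1%N \/ n = p.-1 \/ exists a b, forall x, sg x = a * x + b).
Proof.
case/andP=> n0 np c0 sgI stab bats.
have dual := substitution_stable_dual (ltnW np) c0 sgI bats.
have cV0 x : (c x)^-1 != 0 by rewrite invr_eq0.
have constV : (exists a, forall x, (c x)^-1 = a) -> exists a, forall x, c x = a.
  by case=> a aE; exists a^-1 => x; rewrite -(aE x) invrK.
have [n1|n1] := eqVneq n 1%N.
  by move: stab; rewrite n1 => /substitution_stable_const; split; last by left.
have [n2|n2] := eqVneq n p.-1.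
  split; last by right; left.
  apply/constV/(@substitution_stable_const _ sg).
  by move: dual; rewrite n2 -subn1 subKn ?prime_gt0.
have {n0 n1} n1 : (1 < n)%N by rewrite ltn_neqAle eq_sym n1.
have {np n2} np : (1 < p - n)%N.
  rewrite ltn_subRL addn1; rewrite ltn_neqAle; apply/andP; split=> //.
  by apply: contra n2 => /eqP<-.
have [small|big] := leqP (2 * n) p.
  by have [? ?] := substitution_stable_affine n1 small c0 sgI stab; split=> //; right; right.
have small : (2 * (p - n) <= p)%N.
  by rewrite mulnBr leq_subLR mul2n -addnn leq_add2r ltnW.
have [/constV? ?] := substitution_stable_affine np small cV0 sgI dual.
by split=> //; right; right.
Qed.

End PolynomialFunctions.

(** * Permutations of the plane *)

Section Plane.
Variable p : nat.
Hypothesis hp : prime p.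
Local Notation F := 'F_p.
(** ['F_p] unfolds to ['Z_(pdiv p)], so the plane over it is [Zp2 (pdiv p)]. *)
Local Notation Om := (Zp2 (pdiv p)).
Implicit Types (f h : F -> F) (z : Om) (g : {perm Om}).

Lemma trans_inj f : injective (fun z : Om => (z.1, z.2 + f z.1)%R : Om).
Proof. by case=> [a b] [c d] /= /pair_equal_spec[<- /addIr->]. Qed.

Definition vtrans f : {perm Om} := perm (@trans_inj f).

Lemma vtransE f z : vtrans f z = (z.1, z.2 + f z.1)%R.
Proof. by rewrite permE. Qed.

Lemma htrans_inj (a : F) : injective (fun z : Om => (z.1 + a, z.2)%R : Om).
Proof. by case=> [x b] [c d] /= /pair_equal_spec[/addIr-> ->]. Qed.

Definition htrans a : {perm Om} := perm (@htrans_inj a).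

Lemma htransE a z : htrans a z = (z.1 + a, z.2)%R.
Proof. by rewrite permE. Qed.

Definition vtranses : {set {perm Om}} := [set vtrans f | f : {ffun F -> F}].

Lemma vtransP g : reflect (exists f, forall z, g z = (z.1, z.2 + f z.1)%R)
                          (g \in vtranses).
Proof.
apply: (iffP imsetP) => [[f _ ->]|[f gE]].
  by exists f => z; rewrite vtransE.
exists [ffun x => f x] => //; apply/permP=> z.
by rewrite gE vtransE ffunE.
Qed.

Lemma vtrans_in f : vtrans f \in vtranses.
Proof. by apply/vtransP; exists f => z; rewrite vtransE. Qed.

Lemma vtransesP g : g \in vtranses -> exists f, g = vtrans f.
Proof. by case/vtransP=> f gE; exists f; apply/permP=> z; rewrite vtransE gE. Qed.

Lemma vtransM f h : vtrans f * vtrans h = vtrans (fun x => f x + h x)%R.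
Proof. by apply/permP=> z; rewrite permM !vtransE /= addrA. Qed.

Lemma vtrans_eq f h : f =1 h -> vtrans f = vtrans h.
Proof. by move=> fh; apply/permP=> z; rewrite !vtransE fh. Qed.

Lemma vtrans_inj_fun f h : vtrans f = vtrans h -> f =1 h.
Proof.
move=> fh x; have /(congr1 snd) := congr1 (fun g : {perm Om} => g (x, 0%R)) fh.
by rewrite !vtransE /= !add0r.
Qed.

Lemma vtrans0 : vtrans (fun=> 0%R) = 1.
Proof. by apply/permP=> z; rewrite vtransE perm1 addr0; case: z. Qed.

Lemma vtransX f n : vtrans f ^+ n = vtrans (fun x => f x *+ n)%R.
Proof.
elim: n => [|n IH]; first by rewrite expg0 -vtrans0; apply: vtrans_eq => x.
by rewrite expgS IH vtransM; apply: vtrans_eq => x; rewrite mulrS.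
Qed.

Lemma group_set_vtranses : group_set vtranses.
Proof.
apply/group_setP; split; first by rewrite -vtrans0 vtrans_in.
by move=> _ _ /vtransesP[f ->] /vtransesP[h ->]; rewrite vtransM vtrans_in.
Qed.
Canonical vtranses_group := group group_set_vtranses.

Lemma order_vtrans f : vtrans f ^+ p = 1.
Proof.
rewrite vtransX -vtrans0; apply: vtrans_eq => x.
by rewrite -mulr_natl pchar_Fp_0 // mul0r.
Qed.

Definition wreath_set : {set {perm Om}} :=
  [set vtrans x.1 * htrans x.2 | x : {ffun F -> F} * F].

Lemma wreathP g : reflect
  (exists a, exists f, forall z, g z = (z.1 + a, z.2 + f z.1)%R) (g \in wreath_set).
Proof.
apply: (iffP imsetP) => [[[f a] _ ->]|[a [f gE]]].
  by exists a, f => z; rewrite permM vtransE htransE.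
exists ([ffun x => f x], a) => //; apply/permP=> z.
by rewrite gE permM vtransE htransE ffunE.
Qed.

Lemma group_set_wreath : group_set wreath_set.
Proof.
apply/group_setP; split.
  by apply/wreathP; exists 0%R, (fun=> 0%R) => z; rewrite perm1 !addr0; case: z.
move=> g1 g2 /wreathP[a [f fE]] /wreathP[b [h hE]].
apply/wreathP; exists (a + b)%R, (fun x => f x + h (x + a)%R)%R => z.
by rewrite permM fE hE /= !addrA.
Qed.
Canonical wreath := group group_set_wreath.

Lemma card_wreath : #|wreath| = (p ^ p.+1)%N.
Proof.
rewrite card_imset => [|[f a] [h b] /= fh].
  by rewrite card_prod card_ffun !card_Fp // expnSr.
have /permP fhE := fh.
have E x : (x + a, f x)%R = (x + b, h x)%R.
  by have := fhE (x, 0%R); rewrite !permM !vtransE !htransE /= !add0r.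
congr (_, _); first by apply/ffunP=> x; have [] := E x.
by have /pair_equal_spec[] := E 0%R; rewrite !add0r.
Qed.

Lemma vtranses_sub_wreath : vtranses \subset wreath.
Proof.
apply/subsetP=> _ /vtransesP[f ->]; apply/wreathP.
by exists 0%R, f => z; rewrite vtransE addr0.
Qed.

Lemma htrans_wreath a : htrans a \in wreath.
Proof. by apply/wreathP; exists a, (fun=> 0%R) => z; rewrite htransE addr0. Qed.

Lemma wreath_pgroup : p.-group wreath.
Proof. by rewrite /pgroup card_wreath pnatX pnat_id. Qed.

Lemma vtranses_pgroup : p.-group vtranses.
Proof. exact: pgroupS vtranses_sub_wreath wreath_pgroup. Qed.

Lemma rho1E : rho1 (pdiv p) = vtrans (fun=> 1%R).
Proof. by apply/permP=> z; rewrite permE vtransE. Qed.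

Lemma rho2E : rho2 (pdiv p) = htrans 1%R.
Proof. by apply/permP=> z; rewrite permE htransE. Qed.

Lemma zpermE (i : F) : zperm i = vtrans (fun x => (x == i)%:R%R).
Proof.
apply/permP=> z; rewrite permE vtransE /z_fun.
by case: eqP => _; rewrite ?addr0 //; case: z.
Qed.

Lemma htransX n : htrans 1%R ^+ n = htrans n%:R%R.
Proof.
elim: n => [|n IH]; apply/permP=> z; first by rewrite perm1 htransE addr0; case: z.
by rewrite expgSr permM IH !htransE /= -addrA -mulrSr.
Qed.

Lemma Zp_wr_ZpE : Zp_wr_Zp (pdiv p) = wreath :> {set _}.
Proof.
apply/eqP; rewrite eqEsubset; apply/andP; split.
  rewrite gen_subG subUset sub1set rho2E htrans_wreath /=.
  apply/subsetP=> _ /imsetP[i _ ->]; rewrite zpermE.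
  by apply: (subsetP vtranses_sub_wreath); apply: vtrans_in.
apply/subsetP=> _ /imsetP[[f a] _ ->]; apply: groupM => /=.
  (* The [zperm i] move disjoint columns, so a vertical translation is the product of their powers
     with the values of [f] as exponents. *)
  have -> : vtrans f = \prod_(i : F) (zperm i ^+ val (f i)).
    apply/permP=> z.
    have E (s : seq F) : uniq s -> (\prod_(i <- s) (zperm i ^+ val (f i))) z =
        (z.1, z.2 + (z.1 \in s)%:R * f z.1)%R.
      elim: s z => [|i s IH] z; first by rewrite big_nil perm1 mul0r addr0; case: z.
      move=> /= /andP[nis us]; rewrite big_cons permM IH // zpermE vtransX vtransE /=.
      rewrite in_cons -addrA; congr (_, _ + _)%R.
      case: eqP => [->|_]; last by rewrite mul0rn add0r.
      by rewrite (negPf nis) mul0r addr0 mul1r natrF.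
    by rewrite E ?index_enum_uniq // mem_index_enum mul1r vtransE.
  apply: group_prod => i _; apply: groupX; apply: mem_gen.
  by apply/setUP; right; apply: imset_f.
have -> : htrans a = rho2 (pdiv p) ^+ val a by rewrite rho2E htransX natrF.
by rewrite groupX // mem_gen // setU11.
Qed.

End Plane.

(** * Primitive groups and orbits *)

Section Primitive.
Variables (T : finType) (G : {group {perm T}}).

Lemma transP (x y : T) : [transitive G, on setT | 'P] ->
  exists2 g : {perm T}, g \in G & g x = y.
Proof. by move=> trG; have [g Gg ->] := atransP2 trG (in_setT x) (in_setT y); exists g. Qed.

(** The elements taking [x] to a point reachable from it along [E] form a subgroup [H] above the
    stabiliser of [x], which is maximal. If [H] is the stabiliser, [E] has only loops; if [H = G],
    every point is reachable, although [D] is closed and proper. *)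
Lemma primitive_invariant_rel (E : rel T) (D : {set T}) :
    [primitive G, on setT | 'P] ->
    (forall g x y, g \in G -> E x y -> E (g x) (g y)) ->
    D != set0 -> D != setT -> (forall x y, x \in D -> E x y -> y \in D) ->
  forall x y, E x y -> x = y.
Proof.
move=> primG Einv D0 DT Dcl x0 y0 E00.
have trG : [transitive G, on setT | 'P] by case/andP: primG.
have [x Dx] := set0Pn _ D0.
have [g Gg gx0] := transP x0 x trG.
pose H := [set h in G | connect E x (h x)].
have connG h u v : h \in G -> connect E u v -> connect E (h u) (h v).
  move=> Gh /connectP[s]; elim: s u => [|w s IH] u /= => [_ ->|/andP[Euw /IH{}IH vE]].
    exact: connect0.
  exact: connect_trans (connect1 (Einv _ _ _ Gh Euw)) (IH vE).
have HG : group_set H.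
  apply/group_setP; split; first by rewrite inE group1 perm1 connect0.
  move=> h k /setIdP[Gh xh] /setIdP[Gk xk]; rewrite inE groupM //= permM.
  exact: connect_trans xk (connG _ _ _ Gk xh).
have sHG : H \subset G by apply/subsetP=> h /setIdP[].
have sCH : 'C_G[x | 'P] \subset H.
  apply/subsetP=> h /setIP[Gh /astab1P]; rewrite /= /aperm => hx.
  by rewrite inE Gh hx connect0.
move: primG; rewrite (trans_prim_astab (in_setT x) trG) => /maximal_eqP[_].
case/(_ (group HG) sCH sHG) => /= HE.
  have [h Gh hx] := transP x (g y0) trG.
  have : h \in H by rewrite inE Gh hx connect1 // -gx0 Einv.
  rewrite HE => /setIP[_ /astab1P]; rewrite /= /aperm hx -gx0.
  by move/perm_inj.
have clos u v : u \in D -> connect E u v -> v \in D.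
  move=> Du /connectP[s]; elim: s u Du => [|w s IH] u /= Du; first by move=> _ ->.
  by case/andP=> /(Dcl _ _ Du) Dw /(IH _ Dw)/[apply].
case/eqP: DT; apply/setP=> y; rewrite inE.
have [h Gh <-] := transP x y trG.
have : h \in H by rewrite HE.
by case/setIdP=> _; apply: clos.
Qed.

Definition same_orbital (x y x' y' : T) :=
  [exists g in G, (g x == x') && (g y == y')].

Lemma same_orbitalP x y x' y' :
  reflect (exists g, [/\ g \in G, g x = x' & g y = y']) (same_orbital x y x' y').
Proof.
apply: (iffP exists_inP) => [[g Gg /andP[/eqP<- /eqP<-]]|[g [Gg <- <-]]].
  by exists g.
by exists g; rewrite ?eqxx.
Qed.

Lemma same_orbital_refl x y : same_orbital x y x y.
Proof. by apply/same_orbitalP; exists 1; rewrite !perm1. Qed.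

Lemma same_orbital_sym x y x' y' :
  same_orbital x y x' y' -> same_orbital x' y' x y.
Proof.
case/same_orbitalP=> g [Gg <- <-]; apply/same_orbitalP.
by exists g^-1; rewrite groupV !permK.
Qed.

Lemma same_orbital_trans x y x' y' x'' y'' :
  same_orbital x y x' y' -> same_orbital x' y' x'' y'' -> same_orbital x y x'' y''.
Proof.
case/same_orbitalP=> g [Gg <- <-] /same_orbitalP[h [Gh <- <-]].
by apply/same_orbitalP; exists (g * h); rewrite groupM // !permM.
Qed.

Lemma same_orbital_swap x y x' y' :
  same_orbital x y x' y' -> same_orbital y x y' x'.
Proof.
by case/same_orbitalP=> g [Gg <- <-]; apply/same_orbitalP; exists g.
Qed.

Definition doubly_transitive :=
  forall x y x' y', x != y -> x' != y' -> same_orbital x y x' y'.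

Lemma doubly_transitiveW : 1 < #|T| -> doubly_transitive ->
  [transitive^2 G, on [set: T] | 'P].
Proof.
move=> T1 tr2; have [x [y [_ _ xy]]] : exists x y : T, [/\ x \in T, y \in T & x != y].
  by apply/card_gt1P.
apply/imsetP; exists [tuple x; y].
  by rewrite inE /= inE xy; apply/subsetP=> ? _; rewrite inE.
apply/setP=> t; apply/idP/imsetP => [|[g Gg ->]].
  rewrite inE => /andP[+ _]; case/tupleP: t => x' t; case/tupleP: t => y' t.
  rewrite (tuple0 t) /= inE andbT => xy'.
  have /same_orbitalP[g [Gg gx gy]] := tr2 _ _ _ _ xy xy'.
  by exists g => //; apply: val_inj; rewrite /= /aperm gx gy.
rewrite inE /= inE (inj_eq (act_inj _ _)) xy.
by apply/subsetP=> ? _; rewrite inE.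
Qed.

(* In the language of modular decomposition, [M] is a module of the colouring
   of pairs by the orbitals of [G]. *)
Definition orbital_module (M : {set T}) :=
  [forall z, forall m, forall m',
    [&& z \notin M, m \in M & m' \in M] ==> same_orbital z m z m'].

Lemma orbital_moduleP (M : {set T}) :
  reflect (forall z m m', z \notin M -> m \in M -> m' \in M -> same_orbital z m z m')
          (orbital_module M).
Proof.
apply: (iffP forallP) => [H z m m' zM mM m'M|H z].
  by have /forallP/(_ m)/forallP/(_ m')/implyP := H z; apply; rewrite zM mM.
by apply/forallP=> m; apply/forallP=> m'; apply/implyP=> /and3P[]; apply: H.
Qed.

(* As [G] has no blocks, a maximal module overlaps one of its translates, and
   together they cover everything; then all the pairs going out of the
   complement of the former have the same colour. *)
Lemma primitive_module_transitive2 (M0 : {set T}) :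
    [primitive G, on setT | 'P] -> 1 < #|M0| -> M0 != setT -> orbital_module M0 ->
  doubly_transitive.
Proof.
move=> primG M01 M0T modM0.
have PM0 : [&& 1 < #|M0|, M0 != setT & orbital_module M0] by apply/and3P.
have [M /and3P[M1 MT modM] Mmax] :=
  @arg_maxnP _ M0 [pred A : {set T} | [&& 1 < #|A|, A != setT & orbital_module A]]
    (fun A => #|A|) PM0.
have [m1 [m2 [Mm1 Mm2 m12]]] : exists x y, [/\ x \in M, y \in M & x != y] by apply/card_gt1P.
have M0' : M != set0 by apply/set0Pn; exists m1.
(* [E x y] says that [x] and [y] lie in a common translate of [M]; by primitivity some translate
   leads out of [M]. *)
pose E x y := [exists g in G, (g x \in M) && (g y \in M)].
have [x [y [Mx My Exy]]] : exists x y, [/\ x \in M, y \notin M & E x y].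
  case: (boolP [exists x in M, exists y in ~: M, E x y]) => [|no].
    by case/exists_inP=> x Mx /exists_inP[y]; rewrite inE => My Exy; exists x, y.
  case/eqP: m12; apply: (primitive_invariant_rel (E := E) primG _ M0' MT).
  - move=> g x y Gg /exists_inP[h Gh hxy]; apply/exists_inP; exists (g^-1 * h).
      by rewrite groupM ?groupV.
    by rewrite !permM !permK.
  - move=> x y Mx Exy; apply: contraR no => My; apply/exists_inP; exists x => //.
    by apply/exists_inP; exists y; rewrite // inE.
  by apply/exists_inP; exists 1; rewrite ?group1 // !perm1 Mm1.
case/exists_inP: Exy => g Gg /andP[gx gy].
pose M' := g @^-1: M.
have cM' : #|M'| = #|M|.
  rewrite -(card_imset M' (@perm_inj _ g)); congr #|pred_of_set _|.
  apply/setP=> u; apply/imsetP/idP => [[v + ->]|Mu]; first by rewrite inE.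
  by exists (g^-1 u); rewrite ?inE permKV.
have modM' : forall z m m', z \notin M' -> m \in M' -> m' \in M' -> same_orbital z m z m'.
  move=> z m m'; rewrite !inE => zM mM m'M.
  have /same_orbitalP[h [Gh hz hm]] := orbital_moduleP _ modM _ _ _ zM mM m'M.
  apply/same_orbitalP; exists (g * h * g^-1).
  by rewrite !groupM ?groupV // !permM hz hm !permK.
have {}modM := orbital_moduleP _ modM.
(* Otherwise the union is a larger module: a point outside it sees all of [M] and all of [M'] in the
   colour of the common point [x]. *)
have MU : M :|: M' = setT.
  apply/eqP; apply: contraT => UT; have := Mmax (M :|: M'); rewrite /= UT.
  have sub : M \proper M :|: M'.
    rewrite properE subsetUl; apply/subsetPn; exists y => //.
    by rewrite !inE gy orbT.
  rewrite (ltn_trans M1 (proper_card sub)) leqNgt (proper_card sub).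
  move=> H; suff /H : orbital_module (M :|: M') by [].
  have toX z m : z \notin M :|: M' -> m \in M :|: M' -> same_orbital z m z x.
    rewrite !inE negb_or => /andP[zM zM'] /orP[mM|mM'].
      exact: modM.
    by apply: modM'; rewrite inE.
  apply/orbital_moduleP=> z m m' zM mM mM'.
  exact: same_orbital_trans (toX _ _ zM mM) (same_orbital_sym (toX _ _ zM mM')).
have [m0 Mm0 M'm0] : exists2 m0, m0 \in M & m0 \notin M'.
  apply/subsetPn; apply/negP=> sMM'; case/negP: My.
  have /eqP-> : M == M' by rewrite eqEcard sMM' cM' leqnn.
  by rewrite inE.
have inM' z : z \notin M -> z \in M'.
  by move=> zM; have := in_setT z; rewrite -MU in_setU (negPf zM).
(* First [m] is moved to [m0] inside the module [M]; then, seen from [m0] outside [M'], the point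
   [z] is moved to [y] inside [M']. *)
have mono z m : z \notin M -> m \in M -> same_orbital z m y m0.
  move=> zM mM; apply: same_orbital_trans (modM z m m0 zM mM Mm0) _.
  by apply: same_orbital_swap; apply: modM' => //; apply: inM'.
have D0 : ~: M != set0 by apply/set0Pn; exists y; rewrite inE.
have DT : ~: M != setT.
  by apply/eqP=> /setP/(_ m0); rewrite in_setC Mm0 inE.
(* By [mono], pairs of any other colour never lead from the complement of [M] into [M], so
   primitivity leaves only loops among them. *)
have all1 u v : u != v -> same_orbital u v y m0.
  apply: contraR => Euv; apply/eqP.
  apply: (primitive_invariant_rel
            (E := fun u v => ~~ same_orbital u v y m0) primG _ D0 DT) => //.
    move=> h a b Gh; apply: contra; apply: same_orbital_trans.
    by apply/same_orbitalP; exists h.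
  move=> a b; rewrite !inE => aM; apply: contra => bM; exact: mono.
move=> a b a' b' ab ab'.
exact: same_orbital_trans (all1 _ _ ab) (same_orbital_sym (all1 _ _ ab')).
Qed.

End Primitive.

(** * Orbits of normal and Sylow subgroups *)

Section Orbits.

(** The orbit length |H : H_x| equals |G_x H : G_x|, which divides |G : G_x|. *)
Lemma dvdn_card_orbit_normal (aT : finGroupType) (T : finType)
    (to : {action aT &-> T}) (G H : {group aT}) (S : {set T}) (x : T) :
  [transitive G, on S | to] -> H <| G -> x \in S -> #|orbit to H x| %| #|S|.
Proof.
move=> trG nHG Sx; rewrite -(atransP trG x Sx) !card_orbit.
have sCG : 'C_G[x | to] \subset G by apply: subsetIl.
have nHC : 'C_G[x | to] \subset 'N(H).
  by apply: subset_trans (normal_norm nHG).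
have -> : 'C_H[x | to] = H :&: 'C_G[x | to].
  by rewrite setIA (setIidPl (normal_sub nHG)).
have -> : #|H : H :&: 'C_G[x | to]| = #|'C_G[x | to] <*> H : 'C_G[x | to]|.
  by rewrite norm_joinEl // indexMg indexgI.
have sJG : ('C_G[x | to] <*> H)%G \subset G by rewrite /= join_subG sCG normal_sub.
by rewrite -(Lagrange_index sJG (joing_subl _ _)) dvdn_mull.
Qed.

(** The order of [P] is p^k times the [p]-part of |G_x|, and that [p]-part bounds |P_x|; so the
    orbit of [x] under [P] has at least p^k points. *)
Lemma Sylow_transitive (p : nat) (T : finType) (G P : {group {perm T}}) k :
    prime p -> #|T| = (p ^ k)%N -> [transitive G, on [set: T] | 'P] ->
  p.-Sylow(G) P -> [transitive P, on [set: T] | 'P].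
Proof.
move=> hp oT trG sylP; have [x Sx _] := imsetP trG.
apply/imsetP; exists x => //; apply/esym/eqP; rewrite eqEcard subsetT cardsT oT /=.
have oG : (#|G| = p ^ k * #|'C_G[x | 'P]|)%N.
  by rewrite -(card_orbit_stab 'P G x) (atransP trG x Sx) cardsT oT.
have oP := card_orbit_stab 'P P x.
rewrite (card_Hall sylP) oG in oP.
have C0 : 0 < #|'C_G[x | 'P]| by apply: cardG_gt0.
have pk0 : 0 < p ^ k by rewrite expn_gt0 prime_gt0.
rewrite partnM // part_pnat_id ?pnatX ?pnat_id // in oP.
have le : #|'C_P[x | 'P]| <= #|'C_G[x | 'P]|`_p.
  rewrite dvdn_leq ?part_gt0 //.
  have pC : p.-nat #|'C_P[x | 'P]|.
    by apply: pgroupS (pHall_pgroup sylP); apply: subsetIl.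
  rewrite -(part_pnat_id pC) partn_dvd //; apply: cardSg; apply: setSI.
  exact: pHall_sub sylP.
rewrite -(leq_pmul2r (part_gt0 p #|'C_G[x | 'P]|)) -oP leq_mul2l le orbT //.
Qed.

(* The conjugates of [Q] contain [(p - 1) |K : Q|] nontrivial elements, none of
   them with a fixed point in [S]; the remaining [|K : Q|] elements of [K] must
   then form the stabiliser of every point of [S]. *)
Lemma self_normalizing_regular (p : nat) (T : finType) (S : {set T})
    (K Q : {group {perm T}}) :
    prime p -> #|S| = p -> #|Q| = p -> Q \subset K -> 'N_K(Q) = Q ->
    [transitive K, on S | 'P] ->
    (forall g, g \in K -> (forall z, z \in S -> g z = z) -> g = 1) ->
    (forall g z, g \in Q -> z \in S -> g z = z -> g = 1) ->
  K = Q :> {set {perm T}}.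
Proof.
move=> hp oS oQ sQK nQK trK faith free.
have pQ : prime #|Q| by rewrite oQ.
have p1 : 1 < p := prime_gt1 hp.
have ntQ : Q^# != set0 by rewrite setD_eq0 subG1 trivg_card1 oQ neq_ltn p1 orbT.
(* Conjugates of [Q] sharing a nontrivial element coincide, the order being prime; as [Q] is its own
   normaliser, distinct cosets give disjoint conjugates of [Q^#]. *)
have tiQ : normedTI Q^# K Q.
  apply/normedTI_P; split=> //; first by rewrite normD1 -{1}nQK.
  move=> g Kg; rewrite -setI_eq0 => /set0Pn[w /setIP[/setD1P[w1 Qw]]].
  rewrite conjD1g => /setD1P[_ Qgw].
  have sQ : Q \subset Q :^ g.
    apply: (prime_meetG pQ); apply/trivgPn; exists w => //.
    by rewrite inE Qw.
  rewrite -nQK inE Kg; apply/normP; apply/eqP.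
  by rewrite eq_sym eqEcard sQ cardJg leqnn.
have oCS := card_support_normedTI tiQ.
set CS := class_support Q^# K in oCS.
have sCSK : CS \subset K.
  apply/subsetP=> _ /imset2P[q k /setD1P[_ Qq] Kk ->].
  by rewrite groupJ // (subsetP sQK).
have oQ1 : #|Q^#| = p.-1 by rewrite -oQ [in RHS](cardsD1 1) group1.
have oK : #|K| = (#|K : Q| * p)%N by rewrite -oQ -(Lagrange sQK) mulnC.
have stabE x : x \in S -> 'C_K[x | 'P] = K :\: CS.
  move=> Sx; apply/eqP; rewrite eqEcard; apply/andP; split.
    rewrite subsetD subsetIl /= -setI_eq0; apply/set0Pn=> -[g /setIP[/setIP[_ gx] CSg]].
    have {gx} gx : g x = x by have /astab1P := gx.
    case/imset2P: CSg => q k /setD1P[q1 Qq] Kk gE; case/eqP: q1.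
    apply: (free q (k^-1 x) Qq).
      by rewrite -[_ x]/('P%act x k^-1) (actsP (atrans_acts trK)) ?groupV.
    by apply: (@perm_inj _ k); rewrite -permJ permKV -gE.
  rewrite cardsD (setIidPr sCSK) oCS oQ1.
  have := card_orbit_stab 'P K x; rewrite (atransP trK x Sx) oS oK => e.
  have -> : #|'C_K[x | 'P]| = #|K : Q|.
    by apply/eqP; rewrite -(eqn_pmul2l (prime_gt0 hp)) e mulnC.
  rewrite -[X in (_ * X - _)%N](prednK (prime_gt0 hp)) mulnS.
  by rewrite [(_ * p.-1)%N]mulnC addnK.
have [x Sx] : exists x, x \in S by apply/card_gt0P; rewrite oS prime_gt0.
have stab1 : 'C_K[x | 'P] = 1.
  apply/trivgP/subsetP=> g gx; rewrite inE; apply/eqP; apply: faith.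
    by case/setIP: gx.
  move=> y Sy; have : g \in 'C_K[x | 'P] by [].
  by rewrite (stabE x) // -(stabE y) // => /setIP[_ /astab1P].
apply/eqP; rewrite eq_sym eqEcard sQK oQ -(card_orbit_stab 'P K x) stab1 cards1.
by rewrite (atransP trK x Sx) oS muln1 leqnn.
Qed.

End Orbits.

(** * Transitive subgroups of the wreath product *)

Lemma conjugate_perm_equivalent (T : finType) (A B : {set {perm T}}) (g : {perm T}) :
  A :^ g = B -> perm_equivalent A B.
Proof.
move=> <-; exists g => [|s]; first by exists g^-1; [apply: permK | apply: permKV].
split=> [/imsetP[t At ->]|[t At stE]]; first by exists t => // x; rewrite permJ.
have -> : s = t ^ g by apply/permP=> x; rewrite -[x](permKV g) stE permJ.
by rewrite memJ_conjg.
Qed.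

Section TransitiveSubgroups.
Variable p : nat.
Hypothesis hp : prime p.
Local Notation F := 'F_p.
Local Notation Om := (Zp2 (pdiv p)).
Local Notation wreath := (wreath p).
Implicit Types (f h : F -> F) (z : Om) (g : {perm Om}) (X P : {group {perm Om}}).

Lemma eq_interp f h : f =1 h -> interp f = interp h.
Proof. by move=> fh; apply: eq_bigr => x _; rewrite fh. Qed.

Lemma vtrans_step f h :
  vtrans f ^ (vtrans h * htrans 1%R)^-1 = vtrans (fun x => f (x + 1)%R).
Proof.
rewrite conjgE invgK mulgA; apply: (canLR (mulgK _)); apply/permP=> z.
by rewrite !(permM, vtransE, htransE) /= addrAC.
Qed.

(** Conjugation by the step shifts the argument of a vertical translation, so the polynomials whose
    translations lie in [X] form a shift-invariant family. *)
Lemma vtrans_mem_size X h (q r : {poly F}) :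
    vtrans h * htrans 1%R \in X -> (size q <= p)%N -> vtrans (horner q) \in X ->
  (size r <= size q)%N -> vtrans (horner r) \in X.
Proof.
move=> Xt; apply: (shift_invariant_mem hp (V := fun q => vtrans (horner q) \in X)).
  move=> u v Xu Xv; rewrite (_ : vtrans _ = vtrans (horner u) * vtrans (horner v)).
    exact: groupM.
  by rewrite vtransM; apply: vtrans_eq => x; rewrite hornerD.
move=> u Xu; rewrite (_ : vtrans _ = vtrans (horner u) ^ (vtrans h * htrans 1%R)^-1).
  by rewrite groupJ // groupV.
by rewrite vtrans_step; apply: vtrans_eq => x; rewrite horner_comp !hornerE.
Qed.

(** * The degree bound of a transitive subgroup of the wreath product *)

Section Degree.
Variable P : {group {perm Om}}.
Hypotheses (sPW : P \subset wreath) (trP : [transitive P, on setT | 'P]).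

Lemma transitive_step : exists h, vtrans h * htrans 1%R \in P.
Proof.
have [g Pg gE] := atransP2 trP (in_setT (0, 0)%R) (in_setT (1, 0)%R).
have /wreathP[a [f fE]] := subsetP sPW _ Pg.
move: gE; rewrite /= /aperm fE /= !add0r => /pair_equal_spec[a1 _].
exists f; rewrite (_ : _ * _ = g) //; apply/permP=> z.
by rewrite permM vtransE htransE fE -a1.
Qed.

Lemma transitive_vtrans : exists2 f, vtrans f \in P & f 0%R = 1%R.
Proof.
have [g Pg gE] := atransP2 trP (in_setT (0, 0)%R) (in_setT (0, 1)%R).
have /wreathP[a [f fE]] := subsetP sPW _ Pg.
move: gE; rewrite /= /aperm fE /= !add0r => /pair_equal_spec[a0 f0].
exists f => //; rewrite (_ : vtrans f = g) //; apply/permP=> z.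
by rewrite vtransE fE -a0 addr0.
Qed.

(** Take [n] to be the largest size attained in [P]; shift invariance supplies everything below it,
    and transitivity on a column makes it positive. *)
Lemma transitive_degree : exists2 n, (0 < n <= p)%N &
  forall f, (vtrans f \in P) = (size (interp f) <= n)%N.
Proof.
have [h Ph] := transitive_step.
have vi f : vtrans (horner (interp f)) = vtrans f.
  by apply: vtrans_eq => x; rewrite horner_interp.
pose n := (\max_(f : {ffun F -> F} | vtrans f \in P) size (interp f))%N.
have ffE f : vtrans [ffun x => f x] = vtrans f by apply: vtrans_eq => x; rewrite ffunE.
have le_n f : vtrans f \in P -> (size (interp f) <= n)%N.
  move=> Pf; rewrite (@eq_interp f [ffun x => f x]) => [|x]; last by rewrite ffunE.
  by apply: (leq_bigmax_cond (F := fun f0 : {ffun F -> F} => size (interp f0)));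
     rewrite ffE.
exists n.
  apply/andP; split; last by apply/bigmax_leqP=> f _; apply: size_interp.
  have [f /le_n + f0] := transitive_vtrans; apply: leq_trans.
  rewrite size_poly_gt0; apply: contraTneq (oner_neq0 F) => i0.
  by rewrite -f0 -(horner_interp hp f) i0 horner0 eqxx.
move=> f; apply/idP/idP=> [/le_n//|].
have [|f0 Pf0 fn] := @eq_bigmax_cond _ [pred f : {ffun F -> F} | vtrans f \in P]
                             (fun w : {ffun F -> F} => size (interp w)).
  by apply/card_gt0P; exists [ffun => 0%R]; rewrite inE ffE vtrans0.
rewrite /n fn -(vi f); apply: (vtrans_mem_size Ph); rewrite ?size_interp //.
by rewrite vi.
Qed.

(** An element of [A] moving the columns by [a] becomes a vertical translation once divided by the
    [a]-th power of the step. *)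
Lemma wreath_generated_sub (A B : {group {perm Om}}) h :
    A \subset wreath -> vtrans h * htrans 1%R \in A -> vtrans h * htrans 1%R \in B ->
    (forall f, vtrans f \in A -> vtrans f \in B) ->
  A \subset B.
Proof.
move=> sAW At Bt vAB; apply/subsetP=> g Ag; have /wreathP[a [f gE]] := subsetP sAW _ Ag.
set t := vtrans h * htrans 1%R in At Bt.
rewrite -(mulgKV (t ^+ val a) g); rewrite groupM ?groupX //.
have At' : g * (t ^+ val a)^-1 \in A by rewrite groupM // groupV groupX.
have tX k z : ((t ^+ k) z).1 = (z.1 + k%:R)%R.
  elim: k => [|k IH]; first by rewrite perm1 addr0.
  by rewrite expgSr permM /t permM vtransE htransE /= IH -addrA mulrSr.
have /wreathP[b [u uE]] := subsetP sAW _ At'.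
have b0 : b = 0%R.
  have := congr1 (fun z => ((t ^+ val a) z).1) (uE (0, 0)%R).
  rewrite permM permKV tX gE /= !add0r natrF => aE.
  by apply: (addIr a); rewrite add0r -aE.
have gu : g * (t ^+ val a)^-1 = vtrans u.
  by apply/permP=> z; rewrite uE vtransE b0 addr0.
by rewrite gu vAB // -gu.
Qed.

End Degree.


Lemma val_FpS (x : F) : val (x + 1)%R = (if (val x).+1 == p then 0%N else (val x).+1).
Proof.
have pp : (Zp_trunc (pdiv p)).+2 = p by rewrite pdiv_id // Zp_cast ?prime_gt1.
have xp : (val x < p)%N by apply: leq_trans (ltn_ord x) _; rewrite pp.
have -> : val (x + 1)%R = ((val x).+1 %% p)%N by rewrite /= modnDmr addn1; congr (_ %% _)%N.
by case: eqP => [->|/eqP ne]; rewrite ?modnn // modn_small // ltn_neqAle ne.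
Qed.

Lemma sum_Fp h m : m = p -> (\sum_x h x = \sum_(k < m) h k%:R)%R.
Proof.
move=> mp.
have pp : (Zp_trunc (pdiv p)).+2 = p by rewrite pdiv_id // Zp_cast ?prime_gt1.
transitivity (\sum_(k < (Zp_trunc (pdiv p)).+2) h k%:R)%R; last by rewrite pp mp.
by apply: eq_bigr => x _; rewrite natrF.
Qed.

(** Partial sums of [- h] solve the equation; wrapping around from [p - 1] to 0 is consistent
    because the total is 0. *)
Lemma coboundary h : (\sum_x h x = 0)%R ->
  exists u, forall x : F, (u (x + 1) - u x = - h x)%R.
Proof.
move=> h0; exists (fun x => - \sum_(k < val x) h k%:R)%R => x.
rewrite opprK val_FpS; case: eqP => [xp|_].
  rewrite big_ord0 oppr0 add0r; move: h0; rewrite (sum_Fp _ xp) big_ord_recr /= natrF.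
  by move/eqP; rewrite addr_eq0 => /eqP.
by rewrite big_ord_recr /= natrF opprD addrAC addNr add0r.
Qed.

Lemma vtransV f : (vtrans f)^-1 = vtrans (fun x => - f x)%R.
Proof.
apply: (mulgI (vtrans f)); rewrite mulgV vtransM -vtrans0.
by apply: vtrans_eq => x; rewrite subrr.
Qed.

Lemma step_coboundary h u : (forall x, u (x + 1) - u x = - h x)%R ->
  (vtrans h * htrans 1%R) ^ vtrans u = htrans 1%R.
Proof.
move=> uE; rewrite conjgE vtransV; apply/permP=> z.
rewrite !(permM, vtransE, htransE) /=; congr (_, _).
rewrite -[u (z.1 + 1)%R](subrK (u z.1)) uE.
by rewrite addrA addrK addrNK.
Qed.

(** The values sum to 1, which excludes a degree below [p.-1]. *)
Lemma size_interp_delta (a : F) : size (interp (fun x : F => (x == a)%:R%R)) = p.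
Proof.
apply/eqP; rewrite eqn_leq size_interp // leqNgt; apply/negP=> /(sum_horner_small hp).
rewrite (bigD1 a) //= big1 => [|x xa]; last by rewrite horner_interp // (negPf xa).
by rewrite horner_interp // eqxx addr0 => /eqP; rewrite oner_eq0.
Qed.

(** This displacement function of the last generator of [P_pred_p'] is, up to sign, the difference
    of a delta function, which costs exactly one degree. *)
Lemma size_interp_delta_diff :
  size (interp (fun x : F => - (x == 0)%:R + (x == 1)%:R)%R) = p.-1.
Proof.
pose d := interp (fun x : F => (x == 1)%:R)%R.
have -> : interp (fun x : F => - (x == 0)%:R + (x == 1)%:R)%R = (- (d \Po ('X + 1) - d))%R.
  apply: (poly_fun_inj hp) => [||x].
  - exact: size_interp.
  - by rewrite size_polyN size_diff ?size_interp // (leq_trans (leq_pred _)) ?size_interp.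
  rewrite horner_interp // hornerN hornerD hornerN horner_comp !hornerE.
  rewrite !horner_interp // opprB addrC; congr (_ - (nat_of_bool _)%:R)%R.
  by rewrite -[X in _ = (_ == X)](add0r 1%R) (inj_eq (addIr _)).
by rewrite size_polyN size_diff ?size_interp // size_interp_delta.
Qed.

Lemma size_interp1 : size (interp (fun _ : F => 1%R)) = 1%N.
Proof.
rewrite (_ : interp _ = 1%R) ?size_poly1 //; apply: (poly_fun_inj hp) => [||x].
- exact: size_interp.
- by rewrite size_poly1 prime_gt0.
by rewrite horner_interp // hornerC.
Qed.

(** * Recognition of the three listed groups *)

Section Standard.
Variables (P : {group {perm Om}}) (h : F -> F) (n : nat).
Hypotheses (sPW : P \subset wreath) (Ph : vtrans h * htrans 1%R \in P).
Hypothesis degP : forall f, (vtrans f \in P) = (size (interp f) <= n)%N.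

Lemma degree_sum0 f : (n < p)%N -> vtrans f \in P -> (\sum_x f x = 0)%R.
Proof.
move=> np; rewrite degP => sf; rewrite -[RHS](@sum_horner_small _ hp (interp f)).
  by apply: eq_bigr => x _; rewrite horner_interp.
exact: leq_ltn_trans np.
Qed.

(** Conjugation by a coboundary turns the step of [P] into [htrans 1] and fixes the vertical
    translations. The single element [f], of the largest size [n], then yields all of these by
    shifts. *)
Lemma standard_equivalent (S : {set {perm Om}}) f :
    (\sum_x h x = 0)%R -> htrans 1%R \in S ->
    (forall g, g \in S -> g = htrans 1%R \/ exists2 w, g = vtrans w & g \in P) ->
    vtrans f \in <<S>> -> size (interp f) = n ->
  perm_equivalent P <<S>>.
Proof.
move=> /coboundary[u uE] S1 SP Xf sf.
apply: (@conjugate_perm_equivalent _ _ _ (vtrans u)).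
have Wu : vtrans u \in wreath by apply: (subsetP (@vtranses_sub_wreath p)); apply: vtrans_in.
have Pu w : (vtrans w \in P :^ vtrans u) = (vtrans w \in P).
  rewrite mem_conjg (_ : _ ^ _ = vtrans w) // conjgE invgK vtransV !vtransM.
  by apply: vtrans_eq => x; rewrite addrCA subrr addr0.
have h0 : vtrans (fun=> 0%R) * htrans 1%R = htrans 1%R :> {perm Om}.
  by rewrite vtrans0 mul1g.
have P1 : htrans 1%R \in P :^ vtrans u by rewrite -(step_coboundary uE) memJ_conjg.
apply/eqP; rewrite eqEsubset; apply/andP; split; last first.
  rewrite gen_subG; apply/subsetP=> g /SP[->//|[w -> Pw]].
  by rewrite Pu.
apply: (@wreath_generated_sub (P :^ vtrans u)%G <<S>>%G (fun=> 0%R)); rewrite ?h0 //=.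
- by rewrite conj_subG.
- exact: mem_gen.
move=> w; rewrite Pu degP => sw.
rewrite (@vtrans_eq _ _ (horner (interp w))) => [|x]; last by rewrite horner_interp.
apply: (@vtrans_mem_size <<S>>%G (fun=> 0%R) (interp f)).
- by rewrite h0 mem_gen.
- exact: size_interp.
- by rewrite (@vtrans_eq _ _ f) // => x; rewrite horner_interp.
by rewrite sf.
Qed.

Lemma degree1_equivalent : (\sum_x h x = 0)%R -> n = 1%N ->
  perm_equivalent P (Zp_times_Zp (pdiv p)).
Proof.
move=> h0 n1; have s1 := size_interp1.
apply: (@standard_equivalent _ (fun=> 1%R)); rewrite ?s1 //.
- by rewrite rho2E !inE eqxx orbT.
- move=> g; rewrite !inE rho1E rho2E => /orP[] /eqP->; last by left.
  by right; exists (fun=> 1%R); rewrite // degP s1 n1.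
by rewrite mem_gen // rho1E !inE eqxx.
Qed.

Lemma degree_pred_equivalent : (\sum_x h x = 0)%R -> n = p.-1 ->
  perm_equivalent P (P_pred_p' (pdiv p)).
Proof.
move=> h0 n1; pose d (x : F) := (- (x == 0)%:R + (x == 1)%:R)%R : F.
have dE : (zperm (0%R : F))^-1 * zperm (1%R : F) = vtrans d.
  by rewrite !zpermE vtransV vtransM.
have sd : size (interp d) = p.-1 by apply: size_interp_delta_diff.
have s1 := size_interp1.
apply: (@standard_equivalent _ d); rewrite ?sd //.
- by rewrite rho2E !inE eqxx orbT.
- move=> g; rewrite !inE rho1E rho2E dE -orbA => /or3P[] /eqP->; first 2 last.
  + by right; exists d; rewrite // degP sd n1.
  + right; exists (fun=> 1%R); rewrite // degP s1 n1.
    by rewrite lt0n predp_eq0.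
  by left.
by rewrite mem_gen // dE !inE eqxx orbT.
Qed.

Lemma degree_full_equivalent : n = p -> perm_equivalent P (Zp_wr_Zp (pdiv p)).
Proof.
move=> np; apply: (@conjugate_perm_equivalent _ _ _ 1); rewrite conjsg1 Zp_wr_ZpE //.
apply/eqP; rewrite eqEsubset sPW /=; apply: (@wreath_generated_sub wreath P h) => //.
  rewrite groupM ?htrans_wreath //.
  by apply: (subsetP (@vtranses_sub_wreath p)); apply: vtrans_in.
by move=> f _; rewrite degP np size_interp.
Qed.

End Standard.

End TransitiveSubgroups.

(** * The primitive case *)

Section FrobeniusSum.
Local Open Scope ring_scope.

Lemma pFrobenius_sum_comm (R : nzRingType) (p : nat) (I : Type) (s : seq I)
    (P : pred I) (x : I -> R) :
    p \in [pchar R] -> (forall i j, P i -> P j -> GRing.comm (x i) (x j)) ->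
  (\sum_(i <- s | P i) x i) ^+ p = \sum_(i <- s | P i) x i ^+ p.
Proof.
move=> pR xC; have p0 : (0 < p)%N by apply/prime_gt0/(pcharf_prime pR).
elim: s => [|i s IH]; first by rewrite !big_nil expr0n -[(p == 0)%N]negbK -lt0n p0.
rewrite !big_cons; case: ifP => // Pi.
have /(pFrobenius_autD_comm pR) : GRing.comm (x i) (\sum_(j <- s | P j) x j).
  by apply: commr_sum => j Pj; apply: xC.
by rewrite !pFrobenius_autE IH.
Qed.

End FrobeniusSum.

(** * Schur's argument: the [p]-th power of an orbital matrix *)

Section PowerCount.
Variables (T : finType) (p : nat).
Hypothesis hp : prime p.
Variables (G C : {group {perm T}}) (o : T).
Hypotheses (cC : abelian C) (sCG : C \subset G) (trC : [transitive C, on setT | 'P]).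

(** The points are numbered by ['I_m.+1], a visibly nonempty index type, for the square matrices to
    form a nontrivial ring. *)
Let m := #|T|.-1.
Let cardT : #|T| = m.+1.
Proof. by rewrite prednK //; apply/card_gt0P; exists o. Qed.
Let enc (x : T) : 'I_m.+1 := cast_ord cardT (enum_rank x).
Let dec (i : 'I_m.+1) : T := enum_val (cast_ord (esym cardT) i).
Let encK : cancel enc dec.
Proof. by move=> x; rewrite /dec /enc cast_ordK enum_rankK. Qed.
Let decK : cancel dec enc.
Proof. by move=> i; rewrite /dec /enc enum_valK cast_ordKV. Qed.

Let pmx (g : {perm T}) : 'M['F_p]_m.+1 := (\matrix_(i, j) (g (dec i) == dec j)%:R)%R.

Let mul_pmx g A i j : ((pmx g * A) i j = A (enc (g (dec i))) j)%R.
Proof.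
rewrite mxE (bigD1 (enc (g (dec i)))) //= mxE encK eqxx mul1r big1 ?addr0 // => k kE.
by rewrite mxE -(inj_eq (can_inj encK)) decK eq_sym (negPf kE) mul0r.
Qed.

Let mul_mx_pmx g A i j : ((A * pmx g) i j = A i (enc ((g^-1)%g (dec j))))%R.
Proof.
rewrite mxE (bigD1 (enc ((g^-1)%g (dec j)))) //= mxE encK permKV eqxx mulr1.
rewrite big1 ?addr0 // => k kE.
rewrite mxE -(inj_eq (@perm_inj _ (g^-1)%g)) permK -(inj_eq (can_inj encK)) decK.
by rewrite (negPf kE) mulr0.
Qed.

Let pmxM g h : (pmx (g * h) = pmx g * pmx h)%R.
Proof. by apply/matrixP=> i j; rewrite mul_pmx !mxE encK permM. Qed.

Let pmxX g n : (pmx (g ^+ n) = pmx g ^+ n)%R.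
Proof.
elim: n => [|n IH]; last by rewrite expgS exprS pmxM IH.
rewrite expg0 expr0; apply/matrixP=> i j; rewrite !mxE perm1.
by rewrite (inj_eq (can_inj decK)).
Qed.

(* The orbital of [(o, s)] is a Cayley digraph of the regular abelian group
   [C], hence its adjacency matrix is a sum of commuting permutation matrices
   and taking its [p]-th power in characteristic [p] raises each of them to the
   power [p]. *)
Lemma orbital_power_count s g x y : g \in G ->
  #|[set c in C | same_orbital G o s o (c o) & (c ^+ p) (g x) == g y]| =
  #|[set c in C | same_orbital G o s o (c o) & (c ^+ p) x == y]| %[mod p].
Proof.
move=> Gg; pose S := [pred c | (c \in C) && same_orbital G o s o (c o)].
pose A : 'M['F_p]_m.+1 := (\matrix_(i, j) (same_orbital G o s (dec i) (dec j))%:R)%R.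
(* A transitive abelian group is regular. *)
have regC c d : c \in C -> d \in C -> c o = d o -> c = d.
  move=> Cc Cd cd; apply/permP=> z.
  have [e Ce <-] := transP o z trC.
  by rewrite -!permM (centsP cC e) // (centsP cC e Ce d) // !permM cd.
have orbJ h u v : h \in G -> same_orbital G o s (h u) (h v) = same_orbital G o s u v.
  move=> Gh; apply/idP/idP=> H; apply: same_orbital_trans H _; apply/same_orbitalP.
    by exists h^-1; rewrite groupV !permK.
  by exists h.
have AE : A = (\sum_(c | S c) pmx c)%R.
  apply/matrixP=> i j; rewrite summxE mxE.
  have [d Cd dE] := transP o (dec i) trC.
  have [e Ce eE] := transP (dec i) (dec j) trC.
  have Ge := subsetP sCG e Ce; have Gd := subsetP sCG d Cd.
  have jE : dec j = d (e o) by rewrite -eE -dE -!permM (centsP cC e).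
  have -> : same_orbital G o s (dec i) (dec j) = same_orbital G o s o (e o).
    by rewrite jE -dE orbJ.
  have eq_e c : c \in C -> (c (dec i) == dec j) = (c == e).
    move=> Cc; apply/eqP/eqP=> [cE|-> //]; apply: regC => //.
    by apply: (@perm_inj _ d); rewrite -jE -cE -dE -!permM (centsP cC c).
  case: (boolP (S e)) => Se.
    have /andP[_ ->] := Se; rewrite (bigD1 e) //= mxE eq_e // eqxx.
    rewrite big1 ?addr0 // => c /andP[/andP[Cc _] ce].
    by rewrite mxE eq_e // (negPf ce).
  have := Se; rewrite inE Ce /= => /negPf->; rewrite big1 // => c /andP[Cc oc].
  rewrite mxE eq_e //; case: eqP => // ce; case/negP: Se.
  by rewrite inE Ce -ce.
(* The orbital is invariant under [g], so [A] and its powers commute with the matrix of [g]: their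
   entries agree at [(x, y)] and [(g x, g y)]. *)
have AC : GRing.comm (pmx g) A.
  apply/matrixP=> i j; rewrite mul_pmx mul_mx_pmx !mxE !encK.
  by rewrite -(orbJ g (dec i)) // permKV.
have ApE : (A ^+ p = \sum_(c | S c) pmx (c ^+ p))%R.
  rewrite AE pFrobenius_sum_comm.
  - by apply: eq_bigr => c _; rewrite pmxX.
  - rewrite inE hp /=; apply/eqP.
    by rewrite -scaler_nat pchar_Fp_0 // scale0r.
  move=> c d /andP[Cc _] /andP[Cd _].
  by rewrite /GRing.comm -!pmxM (centsP cC c).
have countE u v : ((A ^+ p) (enc u) (enc v) =
    #|[set c in C | same_orbital G o s o (c o) & (c ^+ p)%g u == v]|%:R)%R.
  rewrite ApE summxE -sum1_card natr_sum big_mkcond [RHS]big_mkcond /=.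
  apply: eq_bigr => c _; rewrite /S /= !inE mxE !encK.
  by case: (c \in C) => //=; case: same_orbital => //=; case: eqP.
have : ((A ^+ p) (enc (g x)) (enc (g y)) = (A ^+ p) (enc x) (enc y))%R.
  have /(congr1 (fun B : 'M_m.+1 => B (enc x) (enc (g y)))) := commrX p AC.
  by rewrite mul_pmx mul_mx_pmx !encK permK.
by rewrite !countE => /(congr1 val); rewrite /= !val_Fp_nat.
Qed.

End PowerCount.

(** * Columns as orbital modules *)

Section PrimitivePlane.
Variable p : nat.
Hypothesis hp : prime p.
Local Notation F := 'F_p.
Local Notation Om := (Zp2 (pdiv p)).
Implicit Types (f h : F -> F) (z : Om) (g : {perm Om}) (G : {group {perm Om}}).

Lemma stepX h k z : ((vtrans h * htrans 1%R) ^+ k) z =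
  (z.1 + k%:R, z.2 + \sum_(j < k) h (z.1 + j%:R))%R.
Proof.
elim: k => [|k IH]; first by rewrite perm1 big_ord0 !addr0; case: z.
by rewrite expgSr permM IH !(permM, vtransE, htransE) /= big_ord_recr -!addrA -mulrSr.
Qed.

(** In [p] steps every column is visited once. *)
Lemma step_p h :
  (vtrans h * htrans 1%R) ^+ p = vtrans (fun=> \sum_x h x)%R.
Proof.
apply/permP=> z; rewrite stepX vtransE pchar_Fp_0 // addr0; congr (_, _ + _)%R.
by rewrite -(sum_Fp hp (fun x => h (z.1 + x)%R)) // [RHS](reindex_inj (addrI z.1)).
Qed.

Definition column (x : F) : {set Om} := [set z | z.1 == x].

Lemma card_column x : #|column x| = p.
Proof.
have yI : injective (fun y : F => (x, y) : Om) by move=> y y' /pair_equal_spec[].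
rewrite -[RHS](card_Fp hp) -(card_imset _ yI); congr #|pred_of_set _|.
apply/setP=> z; rewrite inE; apply/eqP/imsetP=> [<-|[y _ ->] //].
by exists z.2 => //; case: z.
Qed.

Lemma column_neq_setT x : column x != setT.
Proof.
apply/eqP=> /setP/(_ (x + 1, 0)%R); rewrite !inE /=.
by rewrite -subr_eq0 addrAC subrr add0r oner_eq0.
Qed.

Lemma primitive_degree_ge2 (G P : {group {perm Om}}) n :
    P \subset G -> (1 < n)%N -> (forall f, (vtrans f \in P) = (size (interp f) <= n)%N) ->
    [primitive G, on setT | 'P] ->
  doubly_transitive G.
Proof.
move=> sPG n1 degP primG.
apply: (@primitive_module_transitive2 _ _ (column 0%R)) => //.
- by rewrite card_column prime_gt1.
- exact: column_neq_setT.
apply/orbital_moduleP=> z m m'; rewrite !inE => z0 /eqP m0 /eqP m'0.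
(* The polynomial of degree at most 1 that vanishes at the column of [z] and equals [m'.2 - m.2] at
   0. *)
pose q : {poly F} := (((m.2 - m'.2) / z.1) *: ('X - z.1%:P))%R.
apply/same_orbitalP; exists (vtrans (horner q)); split.
- apply: (subsetP sPG); rewrite degP interp_horner //; last first.
    apply: leq_trans (size_scale_leq _ _) _.
    by rewrite size_XsubC prime_gt1.
  apply: (leq_trans _ n1); apply: leq_trans (size_scale_leq _ _) _.
  by rewrite size_XsubC.
- by rewrite vtransE /q !hornerE subrr mulr0 addr0; case: (z).
rewrite vtransE /q !hornerE m0 sub0r mulrN divfK // opprB addrC subrK -m'0.
by case: (m').
Qed.

(** Here [t] generates a regular cyclic group. The counts of the power lemma define an invariant
    relation that stays within columns, trivial by primitivity; so a suborbit meets each column off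
    the origin in 0 or [p] points. *)
Lemma primitive_nonsplit (G : {group {perm Om}}) h :
    (\sum_x h x != 0)%R -> vtrans h * htrans 1%R \in G ->
    [primitive G, on setT | 'P] ->
  doubly_transitive G.
Proof.
set s := (\sum_x h x)%R; set t := vtrans h * htrans 1%R => s0 Gt primG.
pose o : Om := (0, 0)%R; pose C := <[t]>%G.
have sCG : C \subset G by rewrite cycle_subG.
have cC : abelian C by apply: cycle_abelian.
have transC z : exists2 c, c \in C & c o = z.
  pose y := (z.2 - ((t ^+ val z.1)%g o).2)%R.
  exists (t ^+ val z.1 * (t ^+ p) ^+ val (y / s)%R).
    by rewrite groupM ?groupX ?cycle_id.
  rewrite permM step_p vtransX vtransE -/s.
  rewrite -mulr_natr natrF mulrC divfK // /y stepX /= !add0r natrF [(_ + (_ - _))%R]addrC subrK.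
  by case: (z).
have trC : [transitive C, on setT | 'P].
  apply/imsetP; exists o => //; apply/setP=> z; rewrite inE; apply/esym/imsetP.
  by have [c Cc <-] := transC z; exists c.
have regC c d : c \in C -> d \in C -> c o = d o -> c = d.
  move=> Cc Cd cd; apply/permP=> z; have [e Ce <-] := transC z.
  by rewrite -!permM (centsP cC e) // (centsP cC e Ce d) // !permM cd.
(* For [c = t ^+ k], the power [c ^+ p] depends only on [k] modulo [p], which is the column of
   [c o]. *)
have CX c z : c \in C -> (c ^+ p) z = (z.1, z.2 + s * (c o).1)%R.
  case/cycleP=> k ->; rewrite -expgM mulnC expgM step_p vtransX vtransE stepX /=.
  by rewrite add0r mulr_natr.
(* The points of the orbital that lie in a column off the origin are counted,
   up to a translation, by the [p]-th power of its adjacency matrix. *)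
have key w x : x != 0%R ->
  #|[set c in C | same_orbital G o w o (c o) & (c o).1 == x]| = 0 %[mod p].
  move=> x0; pose N u v := #|[set c in C | same_orbital G o w o (c o) & (c ^+ p) u == v]|.
  have NE : N o (0, s * x)%R = #|[set c in C | same_orbital G o w o (c o) & (c o).1 == x]|.
    congr #|pred_of_set _|; apply/setP=> c; rewrite !inE; case Cc: (c \in C) => //=.
    rewrite CX // add0r xpair_eqE eqxx (inj_eq (mulfI s0)) //.
  rewrite -NE; apply/eqP; apply: contraT => N0.
  have /(congr1 snd)/= : o = (0, s * x)%R.
    apply: (primitive_invariant_rel (E := fun u v => N u v != 0 %[mod p])
             (D := column 0%R) primG) => //.
    - by move=> g u v Gg; rewrite /N (orbital_power_count hp o cC sCG trC).
    - by apply/set0Pn; exists o; rewrite inE.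
    - exact: column_neq_setT.
    move=> u v; rewrite !inE => /eqP u0 Nuv.
    have : 0 < N u v by rewrite lt0n; apply: contra Nuv => /eqP->.
    case/card_gt0P=> c; rewrite !inE => /and3P[Cc _ /eqP<-].
    by rewrite CX //= u0.
  by move/esym/eqP; rewrite mulf_eq0 (negPf s0) (negPf x0).
have col_orb (u v : Om) : u.1 != 0%R -> u.1 = v.1 -> same_orbital G o u o v.
  move=> u0 uv; pose B := [set c in C | same_orbital G o u o (c o) & (c o).1 == u.1].
  pose D := (fun c : {perm Om} => c o) @: B.
  have cD : #|D| = #|B|.
    apply: card_in_imset => c d; rewrite !inE => /andP[Cc _] /andP[Cd _]; exact: regC.
  have sDu : D \subset column u.1.
    by apply/subsetP=> _ /imsetP[c + ->]; rewrite !inE => /and3P[].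
  have Du : u \in D.
    have [c Cc cu] := transC u; apply/imsetP; exists c => //.
    by rewrite !inE Cc cu same_orbital_refl eqxx.
  have B0 : 0 < #|B| by rewrite -cD; apply/card_gt0P; exists u.
  have pB : p %| #|B| by apply/eqP; rewrite -(mod0n p); apply: key.
  have DE : D = column u.1.
    by apply/eqP; rewrite eqEcard sDu card_column cD dvdn_leq.
  have : v \in D by rewrite DE inE uv.
  by case/imsetP=> c; rewrite !inE => /and3P[_ + _] ->.
apply: (@primitive_module_transitive2 _ _ (column 0%R)) => //.
- by rewrite card_column prime_gt1.
- exact: column_neq_setT.
apply/orbital_moduleP=> z m m'; rewrite !inE => z0 /eqP m0 /eqP m'0.
(* A power of [t] brings [z] to the origin and column 0 to the column [- z.1], which is off the
   origin. *)
have [c Cc cz] := transC z; have Gc : c^-1 \in G by rewrite groupV (subsetP sCG).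
have cz' : c^-1 z = o by rewrite -cz permK.
have cV1 u : (c^-1 u).1 = (u.1 - z.1)%R.
  apply: (canRL (addrK _)); rewrite -[in RHS](permKV c u) -cz.
  case/cycleP: Cc => k ->.
  by rewrite !stepX /= add0r.
have toO u : same_orbital G z u o (c^-1 u).
  by apply/same_orbitalP; exists c^-1.
apply: same_orbital_trans (toO m) _; apply: same_orbital_trans (same_orbital_sym (toO m')).
by apply: col_orb; rewrite !cV1 m0 ?m'0 // sub0r oppr_eq0.
Qed.

End PrimitivePlane.

(** * The imprimitive case *)

Section Columns.
Variable p : nat.
Hypothesis hp : prime p.
Local Notation F := 'F_p.
Local Notation Om := (Zp2 (pdiv p)).
Local Notation wreath := (wreath p).
Local Notation vtranses := (vtranses p).
Local Notation rho := (vtrans (fun=> 1%R) : {perm Om}).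
Implicit Types (f h : F -> F) (z : Om) (g : {perm Om}).

Definition col_preserving (A : {set {perm Om}}) :=
  forall g, g \in A -> forall z z', z.1 = z'.1 -> (g z).1 = (g z').1.

Lemma card_Om : #|Om| = (p ^ 2)%N.
Proof. by rewrite card_prod card_Fp. Qed.

(** On each column [vtrans f] acts as a power of [rho], so its conjugate is determined by [rho ^ g]
    and the permutation [sg] of the columns. *)
Lemma vtrans_conj (G : {group {perm Om}}) g :
    col_preserving G -> g \in G -> rho ^ g \in vtranses ->
  exists c sg, [/\ rho ^ g = vtrans c, forall x, c x != 0%R, injective sg,
    forall z, (g^-1 z).1 = sg z.1 &
    forall f, vtrans f ^ g = vtrans (fun x => c x * f (sg x))%R].
Proof.
move=> colG Gg /vtransesP[c rE]; pose sg (w : F) := (g^-1 (w, 0%R)).1.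
have sgE z : (g^-1 z).1 = sg z.1 by apply: colG => //; rewrite groupV.
have rhoJ z : g (rho z) = vtrans c (g z) by rewrite -rE permJ.
exists c, sg; split=> //.
- move=> x; apply/eqP=> cx; have := rhoJ (g^-1 (x, 0%R)).
  rewrite permKV (vtransE c) /= cx addr0 -[X in _ = X](permKV g) => /perm_inj.
  rewrite vtransE => /(congr1 snd)/= /eqP.
  by rewrite -subr_eq0 addrAC subrr add0r oner_eq0.
- move=> x y xy.
  have : (g (g^-1 (x, 0%R))).1 = (g (g^-1 (y, 0%R))).1 by apply: (colG g).
  by rewrite !permKV.
move=> f; apply/permP=> z; rewrite -[z](permKV g) permJ.
set u := g^-1 z; have fu : vtrans f u = (rho ^+ val (f u.1)) u.
  by rewrite vtransX !vtransE -mulr_natl natrF mulr1.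
by rewrite fu -permJ conjXg rE vtransX !vtransE permKV -sgE -mulr_natr natrF.
Qed.

(** * The case of a normal group of vertical translations *)

Section NormalCase.
Variables (G P : {group {perm Om}}) (h : F -> F) (n : nat).
Hypotheses (sylP : p.-Sylow(G) P) (trP : [transitive P, on setT | 'P]).
Hypotheses (colG : col_preserving G) (sPW : P \subset wreath).
Hypothesis Ph : vtrans h * htrans 1%R \in P.
Hypotheses (n_bounds : (0 < n < p)%N)
  (degP : forall f, (vtrans f \in P) = (size (interp f) <= n)%N).
Hypothesis nonstandard : (\sum_x h x != 0)%R \/ n <> 1%N /\ n <> p.-1.
Hypothesis normQ : G \subset 'N(vtranses :&: P).

Let sPG : P \subset G. Proof. exact: pHall_sub sylP. Qed.
Let n_ltp : (n < p)%N. Proof. by case/andP: n_bounds. Qed.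

Let Prho : rho \in P. Proof. by rewrite degP size_interp1 //; case/andP: n_bounds. Qed.

Let normP f g : g \in G -> vtrans f \in P -> (vtrans f ^ g \in vtranses) && (vtrans f ^ g \in P).
Proof.
move=> Gg Pf; rewrite -in_setI memJ_norm ?(subsetP normQ) //.
by rewrite in_setI vtrans_in.
Qed.

Let rhoJ g : g \in G -> rho ^ g \in vtranses.
Proof. by move=> Gg; case/andP: (normP Gg Prho). Qed.

(** Conjugation by [g] and by its inverse preserves the functions of size at most [n], which are the
    hypotheses of the rigidity lemma. *)
Lemma normal_case_rigid g : g \in G ->
  (exists a, rho ^ g = vtrans (fun=> a)) /\
  (n = 1%N \/ n = p.-1 \/ exists a b, forall z, (g^-1 z).1 = (a * z.1 + b)%R).
Proof.
move=> Gg; have [c [sg [rE c0 sgI sgE JE]]] := vtrans_conj colG Gg (rhoJ Gg).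
have vi f : vtrans (horner (interp f)) = vtrans f.
  by apply: vtrans_eq => x; rewrite horner_interp.
have Pq (q : {poly F}) : (size q <= n)%N -> vtrans (horner q) \in P.
  by move=> sq; rewrite degP interp_horner // (leq_trans sq) ?(ltnW n_ltp).
have [|q sq|[a cE] tri] := substitution_stable_rigid hp n_bounds c0 sgI.
- move=> q sq; exists (interp (fun x => c x * q.[sg x])%R) => [|x].
    by rewrite -degP -JE; case/andP: (normP Gg (Pq q sq)).
  by rewrite horner_interp.
- have /(normP (groupVr Gg))/andP[/vtransesP[f fE] Pf] := Pq q sq.
  exists (interp f) => [|x]; first by rewrite -degP -fE.
  rewrite horner_interp //; apply: (@vtrans_inj_fun p (horner q) (fun x => c x * f (sg x))%R).
  by rewrite -JE -fE conjgKV.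
split; first by exists a; rewrite rE; apply: vtrans_eq.
case: tri => [|[|[b [d sgbd]]]]; [by left | by right; left | right; right].
by exists b, d => z; rewrite sgE.
Qed.

Let C := 'C_G[rho]%G.

(** By rigidity the conjugates of [rho] are powers of it, so [<[rho]>] and its centraliser are
    normal in [G]. *)
Let normalC : C <| G.
Proof.
have -> : C = 'C_G(<[rho]>) :> {set _} by rewrite /= cent_cycle.
have {2}<- : 'N_G(<[rho]>) = G.
  apply/setIidPl/subsetP=> g Gg; rewrite inE -genJ gen_subG conjg_set1 sub1set.
  have [[a ->] _] := normal_case_rigid Gg.
  apply/cycleP; exists (val a); rewrite vtransX; apply: vtrans_eq => x.
  by rewrite natrF.
exact: subcent_normal.
Qed.

Let sPC : P \subset C.
Proof.
apply/subsetP=> w Pw; rewrite inE (subsetP sPG) //=; apply/cent1P.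
have /wreathP[a [f fE]] := subsetP sPW _ Pw.
by apply/permP=> z; rewrite !permM fE !vtransE fE /= addrAC.
Qed.

(** Commuting with [rho] forces a translation from each column to its image, determined by the point
    in row 0. *)
Let CE g z : g \in C -> g z = ((g (z.1, 0)).1, z.2 + (g (z.1, 0)).2)%R.
Proof.
case/setIP=> _ /cent1P gr.
have -> : z = (rho ^+ val z.2) (z.1, 0)%R.
  by rewrite vtransX vtransE /= add0r natrF; case: (z).
rewrite -permM -(commuteX _ gr) permM vtransX !vtransE /= natrF add0r addrC.
by [].
Qed.

(** The vertical translations in [G] form a normal [p]-subgroup, so they lie in every Sylow
    subgroup. *)
Lemma vtranses_sub_Sylow : vtranses :&: G \subset P.
Proof.
apply: subset_trans (pcore_sub_Hall sylP); apply: pcore_max.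
  exact: pgroupS (subsetIl _ _) (vtranses_pgroup hp).
rewrite /normal subsetIr; apply/subsetP=> g Gg; rewrite inE.
apply/subsetP=> _ /imsetP[_ /setIP[/vtransesP[f ->] Gf] ->].
have [c [sg [_ _ _ _ JE]]] := vtrans_conj colG Gg (rhoJ Gg).
by rewrite in_setI -[_ \in vtranses]andbT {1}JE vtrans_in groupJ.
Qed.

(** [P] equals [C :&: wreath], a [p]-group containing it: the elements of [C] that translate the
    columns. An affine action on the columns preserves this property under conjugation. *)
Let affine_normal :
  (forall g, g \in G -> exists a b, forall z, (g^-1 z).1 = (a * z.1 + b)%R) -> P <| G.
Proof.
move=> aff; rewrite /normal sPG; apply/subsetP=> g Gg; rewrite inE.
have PE : C :&: wreath = P.
  apply: (@sub_pHall _ _ P G (C :&: wreath)%G sylP).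
  - by apply: pgroupS (wreath_pgroup hp); apply: subsetIr.
  - by rewrite subsetI sPC.
  by rewrite /= subIset // (normal_sub normalC).
apply/subsetP=> _ /imsetP[w Pw ->]; rewrite -PE inE.
have Cw : w ^ g \in C by rewrite memJ_norm ?(subsetP sPC) // (subsetP (normal_norm normalC)).
rewrite Cw /=; apply/wreathP.
have [a [b abE]] := aff g Gg; have /wreathP[d [f fE]] := subsetP sPW _ Pw.
have a0 : a != 0%R.
  apply/eqP=> a0; have E x : (g^-1 (g x)).1 = b by rewrite abE a0 mul0r add0r.
  have := E (b + 1, 0)%R; rewrite permK /= => /eqP.
  by rewrite -subr_eq0 addrAC subrr add0r oner_eq0.
exists (d / a)%R, (fun x => ((w ^ g) (x, 0)%R).2) => z.
rewrite (CE z Cw); congr (_, _).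
set z0 : Om := (z.1, 0)%R.
have e1 : (g^-1 ((w ^ g) z0)).1 = (((g^-1)%g z0).1 + d)%R.
  by rewrite -[z0 in LHS](permKV g) permJ permK fE.
move: e1; rewrite !abE addrAC => /addIr e1.
by apply: (mulfI a0); rewrite e1 mulrDr mulrCA divff // mulr1.
Qed.

(* A homomorphism on [C] that vanishes on the vertical translations of [P], but
   not on [P] unless [sum_x h x = 0]. *)
Let shift_sum g : F := (\sum_x (g (x, 0)).2)%R.

Let shift_sumM g k : g \in C -> k \in C -> shift_sum (g * k)%g = (shift_sum g + shift_sum k)%R.
Proof.
move=> Cg Ck; pose sg (x : F) := (g (x, 0)%R).1.
have sgI : injective sg.
  move=> x y xy.
  have : (g^-1 (g (x, 0)%R)).1 = (g^-1 (g (y, 0)%R)).1.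
    by apply: colG => //; rewrite groupV; case/setIP: Cg.
  by rewrite !permK.
rewrite {3}/shift_sum (reindex_inj sgI) -big_split; apply: eq_bigr => x _ /=.
by rewrite permM (CE _ Ck) /sg.
Qed.

Let shift_sum_vtrans f : shift_sum (vtrans f) = (\sum_x f x)%R.
Proof. by apply: eq_bigr => x _; rewrite vtransE /= add0r. Qed.

(** The kernel [C2] of [shift_sum] meets [P] in vertical translations, as [t ^+ k] contributes [k]
    times the nonzero sum. Its orbits contain columns; were it transitive, so would be its Sylow
    subgroup [C2 :&: P]. Hence [C2] is vertical and lies in [P]. It contains the commutators of [C],
    so [P] is normal in [C], and as the [p]-core of [C] it is normal in [G]. *)
Let nonsplit_normal : (\sum_x h x != 0)%R -> P <| G.
Proof.
move=> s0; pose C2set := [set g in C | shift_sum g == 0%R].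
have C2G : group_set C2set.
  apply/group_setP; split.
    by rewrite inE group1 -vtrans0 shift_sum_vtrans big1 ?eqxx.
  move=> g k /setIdP[Cg /eqP g0] /setIdP[Ck /eqP k0].
  by rewrite inE groupM // shift_sumM // g0 k0 addr0 eqxx.
pose C2 := group C2G.
have sC2C : C2 \subset C by apply/subsetP=> g /setIdP[].
have nC2C : C2 <| C.
  rewrite /normal sC2C; apply/subsetP=> g Cg; rewrite inE.
  apply/subsetP=> _ /imsetP[k /setIdP[Ck k0] ->]; rewrite inE groupJ //=.
  have := shift_sumM Cg (groupJ Ck Cg).
  by rewrite -conjgC shift_sumM // addrC => /addrI <-.
have trC : [transitive C, on setT | 'P].
  apply/imsetP; exists (0, 0)%R => //; apply/esym/eqP; rewrite eqEsubset subsetT /=.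
  rewrite -(atransP trP (0, 0)%R (in_setT _)); apply: imsetS; exact: sPC.
have PC2 : C2 :&: P \subset vtranses.
  apply/subsetP=> w /setIP[/setIdP[Cw /eqP w0] Pw].
  have [k vk] : exists k, w * ((vtrans h * htrans 1%R) ^+ k)^-1 \in vtranses.
    have /wreathP[a [f fE]] := subsetP sPW _ Pw; exists (val a).
    have : w * ((vtrans h * htrans 1%R) ^+ val a)^-1 \in wreath.
      by rewrite (subsetP sPW) // groupM // groupV groupX.
    case/wreathP=> b [u uE]; apply/vtransP; exists u => z; rewrite uE.
    have := congr1 (fun z => (((vtrans h * htrans 1%R) ^+ val a)%g z).1) (uE z).
    rewrite permM permKV stepX fE /= natrF => /addIr e.
    have b0 : b = 0%R by apply: (addrI z.1); rewrite addr0.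
    by rewrite b0 addr0.
  have [u uE] := vtransesP vk.
  have Pu : vtrans u \in P by rewrite -uE groupM // groupV groupX.
  have wE : w = vtrans u * (vtrans h * htrans 1%R) ^+ k by rewrite -uE mulgKV.
  have SX : shift_sum ((vtrans h * htrans 1%R) ^+ k) = ((\sum_x h x) * k%:R)%R.
    elim: k {vk uE wE} => [|k IH].
      by rewrite expg0 -vtrans0 shift_sum_vtrans big1 // mulr0.
    rewrite expgSr shift_sumM ?groupX ?(subsetP sPC) // IH -natr1 mulrDr mulr1; congr (_ + _)%R.
    by apply: eq_bigr => x _; rewrite permM vtransE htransE /= add0r.
  move: w0; rewrite wE shift_sumM ?groupX ?(subsetP sPC) // SX shift_sum_vtrans.
  rewrite (degree_sum0 hp degP n_ltp Pu) add0r => sk.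
  have k0 : k%:R%R = 0%R :> F.
    by move/eqP: sk; rewrite mulf_eq0 (negPf s0) => /eqP.
  rewrite groupM ?vtrans_in //; apply/vtransP.
  exists (fun x => \sum_(j < k) h (x + j%:R))%R => z; rewrite stepX.
  by rewrite k0 addr0.
have C2rho : rho \in C2.
  rewrite inE (subsetP sPC) //= shift_sum_vtrans sumr_const card_Fp //.
  by rewrite pchar_Fp_0.
have C2col g z : g \in C2 -> (g z).1 = z.1.
  move=> C2g; have sub : column z.1 \subset orbit 'P C2 z.
    apply/subsetP=> y; rewrite inE => /eqP yz; apply/imsetP.
    pose k := (y.2 - z.2)%R; exists (rho ^+ val k); first by rewrite groupX.
    have kE : (val k)%:R%R = k by apply: natrF.
    by rewrite /= /aperm vtransX vtransE kE /k addrC subrK -yz; case: (y).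
  have gz : g z \in orbit 'P C2 z by apply: (mem_orbit 'P z C2g).
  have dv : #|orbit 'P C2 z| %| p ^ 2.
    by rewrite -card_Om -cardsT; apply: (dvdn_card_orbit_normal trC) => //; rewrite inE.
  have [[|[|[|m]]] // _ oE] := dvdn_pfactor _ _ hp dv.
  - by have := subset_leq_card sub; rewrite card_column // oE leqNgt prime_gt1.
  - have /eqP oc : column z.1 == orbit 'P C2 z by rewrite eqEcard sub oE card_column // leqnn.
    by move: gz; rewrite -oc inE => /eqP.
  have oT : orbit 'P C2 z = setT.
    by apply/eqP; rewrite eqEcard subsetT cardsT card_Om oE leqnn.
  have tr2 : [transitive C2, on setT | 'P] by apply/imsetP; exists z.
  have sylC : p.-Sylow(C) P := pHall_subl sPC (normal_sub normalC) sylP.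
  have tr := Sylow_transitive hp card_Om tr2 (Sylow_setI_normal nC2C sylC).
  have [w /(subsetP PC2)/vtransP[f fE] /esym] := atransP2 tr (in_setT (0, 0)%R) (in_setT (1, 0)%R).
  by rewrite /= /aperm fE /= => /pair_equal_spec[/esym/eqP]; rewrite oner_eq0.
have C2P : C2 \subset P.
  apply: subset_trans vtranses_sub_Sylow; apply/subsetP=> g C2g.
  have Cg := subsetP sC2C g C2g.
  rewrite in_setI (subsetP (normal_sub normalC)) // andbT; apply/vtransP.
  by exists (fun x => (g (x, 0)).2)%R => z; rewrite {1}(CE z Cg) C2col.
have nPC : P <| C.
  rewrite /normal sPC; apply/subsetP=> g Cg; rewrite inE.
  apply/subsetP=> _ /imsetP[w Pw ->]; have Cw := subsetP sPC w Pw.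
  rewrite conjg_mulR groupM // (subsetP C2P) // inE groupR //=.
  have := shift_sumM (groupM Cg Cw) (groupR Cw Cg).
  rewrite -commgC (shift_sumM Cw Cg) (shift_sumM Cg Cw) => e; apply/eqP.
  by apply: (addrI (shift_sum g + shift_sum w)%R); rewrite -e addr0 addrC.
have sylC : p.-Sylow(C) P := pHall_subl sPC (normal_sub normalC) sylP.
by rewrite -(normal_Hall_pcore sylC nPC) (char_normal_trans (pcore_char _ _)).
Qed.

Lemma normal_case : P <| G.
Proof.
case: nonstandard => [|[n1 n2]]; first exact: nonsplit_normal.
by apply: affine_normal => g /normal_case_rigid[_ [|[]]].
Qed.

End NormalCase.
End Columns.

(** * The kernel [K] of the action on the set of columns *)

Section Kernel.
Variable p : nat.
Hypothesis hp : prime p.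
Local Notation F := 'F_p.
Local Notation Om := (Zp2 (pdiv p)).
Local Notation wreath := (wreath p).
Local Notation vtranses := (vtranses p).
Local Notation rho := (vtrans (fun=> 1%R) : {perm Om}).
Implicit Types (f h : F -> F) (z : Om) (g : {perm Om}) (S : {set F}).

Variables (G P : {group {perm Om}}) (h : F -> F) (n : nat).
Hypotheses (sylP : p.-Sylow(G) P) (trP : [transitive P, on setT | 'P]).
Hypotheses (colG : col_preserving G) (sPW : P \subset wreath).
Local Notation t := (vtrans h * htrans 1%R : {perm Om}).
Hypothesis Ph : t \in P.
Hypotheses (n_bounds : (0 < n < p)%N)
  (degP : forall f, (vtrans f \in P) = (size (interp f) <= n)%N).

Let sPG : P \subset G. Proof. exact: pHall_sub sylP. Qed.
Let n_ltp : (n < p)%N. Proof. by case/andP: n_bounds. Qed.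
Let Prho : rho \in P. Proof. by rewrite degP size_interp1 //; case/andP: n_bounds. Qed.

Definition col_fixing : {set {perm Om}} := [set g in G | [forall z, (g z).1 == z.1]].

Lemma col_fixingP g :
  reflect (g \in G /\ forall z, (g z).1 = z.1) (g \in col_fixing).
Proof.
rewrite inE; apply: (iffP andP) => [[Gg /forallP H]|[Gg H]].
  by split=> // z; apply/eqP.
by split=> //; apply/forallP=> z; apply/eqP.
Qed.

Lemma group_set_col_fixing : group_set col_fixing.
Proof.
apply/group_setP; split; first by apply/col_fixingP; split=> // z; rewrite perm1.
move=> g k /col_fixingP[Gg g1] /col_fixingP[Gk k1]; apply/col_fixingP.
by split=> [|z]; rewrite ?groupM // permM k1.
Qed.
Let K := group group_set_col_fixing.

Lemma normal_col_fixing : K <| G.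
Proof.
rewrite /normal; apply/andP; split; first by apply/subsetP=> g /setIdP[].
apply/subsetP=> g Gg; rewrite inE; apply/subsetP=> _ /imsetP[k /col_fixingP[Gk k1] ->].
apply/col_fixingP; split=> [|z]; first by rewrite groupJ.
by rewrite -[z](permKV g) permJ; apply: (colG Gg); rewrite k1.
Qed.

Lemma col_fixing_Sylow : K :&: P = vtranses :&: P.
Proof.
apply/setP=> g; rewrite !in_setI; apply: andb_id2r => Pg.
apply/col_fixingP/vtransP=> [[_ g1]|[f fE]].
  have /wreathP[a [f fE]] := subsetP sPW _ Pg; exists f => z.
  by rewrite fE; congr (_, _); have := g1 z; rewrite fE.
by split=> [|z]; rewrite ?(subsetP sPG) // fE.
Qed.

Let sylK : p.-Sylow(K) (K :&: P).
Proof. exact: Sylow_setI_normal normal_col_fixing sylP. Qed.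

Let Krho : rho \in K.
Proof. by apply/col_fixingP; split=> [|z]; rewrite ?(subsetP sPG) // vtransE. Qed.

Let rhoX z y : (rho ^+ val (y - z.2)%R) z = (z.1, y).
Proof.
pose k := (y - z.2)%R; have kE : (val k)%:R%R = k by apply: natrF.
by rewrite vtransX vtransE kE /k addrC subrK.
Qed.

Let trK c : [transitive K, on column c | 'P].
Proof.
apply/imsetP; exists (c, 0)%R; first by rewrite inE.
apply/setP=> z; rewrite inE; apply/eqP/imsetP=> [zc|[g Kg ->]].
  exists (rho ^+ val (z.2 - (c, 0)%R.2)%R); first exact: groupX.
  by rewrite /= /aperm (rhoX (c, 0)%R) /= -zc; case: (z).
by have /col_fixingP[_ /= ->] := Kg.
Qed.

(** Orbit lengths of a normal subgroup of [K] on a column divide the prime [p]. *)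
Lemma column_alternative (H : {group {perm Om}}) c : H <| K ->
  (forall g z, g \in H -> z.1 = c -> g z = z) \/ [transitive H, on column c | 'P].
Proof.
move=> nHK; have sub z : z.1 = c -> orbit 'P H z \subset column c.
  move=> zc; apply/subsetP=> _ /imsetP[g Hg ->]; rewrite inE.
  by have /col_fixingP[_ /= ->] := subsetP (normal_sub nHK) g Hg; rewrite zc.
have [/exists_inP[z]|no] := boolP [exists z in column c, #|orbit 'P H z| == p].
  rewrite inE => /eqP zc /eqP oz; right; apply/imsetP; exists z; first by rewrite inE zc.
  by apply/esym/eqP; rewrite eqEcard sub // oz card_column // leqnn.
left=> g z Hg zc; have cz : z \in column c by rewrite inE zc.
have := dvdn_card_orbit_normal (trK c) nHK cz; rewrite card_column // => dv.
have : #|orbit 'P H z| == 1%N.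
  have /primeP[_ /(_ _ dv)/orP[//|op]] := hp.
  by case/existsP: no; exists z; rewrite cz.
case/cards1P=> u oE; have : z \in orbit 'P H z by apply: orbit_refl.
have : g z \in orbit 'P H z by apply: (mem_orbit 'P z Hg).
by rewrite oE !inE => /eqP-> /eqP.
Qed.

Definition col_stab S : {set {perm Om}} :=
  [set g in K | [forall z, (z.1 \in S) ==> (g z == z)]].

Lemma col_stabP S g :
  reflect (g \in K /\ forall z, z.1 \in S -> g z = z) (g \in col_stab S).
Proof.
apply: (iffP setIdP) => [[Kg /forallP H]|[Kg H]].
  by split=> // z zS; have := H z; rewrite zS => /eqP.
by split=> //; apply/forallP=> z; apply/implyP=> /H->.
Qed.

Lemma group_set_col_stab S : group_set (col_stab S).
Proof.
apply/group_setP; split; first by apply/col_stabP; split=> // z; rewrite perm1.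
move=> g k /col_stabP[Kg gS] /col_stabP[Kk kS]; apply/col_stabP.
by split=> [|z zS]; rewrite ?groupM // permM gS // kS.
Qed.
Let L S := group (group_set_col_stab S).

Let normalL S : L S <| K.
Proof.
rewrite /normal; apply/andP; split; first by apply/subsetP=> g /setIdP[].
apply/subsetP=> g Kg; rewrite inE; apply/subsetP=> _ /imsetP[k /col_stabP[Kk kS] ->].
apply/col_stabP; split=> [|z zS]; first by rewrite groupJ.
rewrite -[z](permKV g) permJ kS //.
by have /col_fixingP[_ ->] : g^-1 \in K by rewrite groupV.
Qed.

Let L_U1 S c g : g \in L S -> (forall z, z.1 = c -> g z = z) -> g \in L (c |: S).
Proof.
case/col_stabP=> Kg gS gc; apply/col_stabP; split=> // z.
by rewrite !inE => /orP[/eqP/gc|/gS].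
Qed.

Let L_T : L setT = 1%G.
Proof.
apply/trivGP/subsetP=> g /col_stabP[_ gT]; rewrite inE; apply/eqP/permP=> z.
by rewrite gT ?perm1 // inE.
Qed.

Let tX1 k z : ((t ^+ k) z).1 = (z.1 + k%:R)%R.
Proof. by rewrite stepX. Qed.

Let KJ g k : g \in K -> g ^ (t ^+ k) \in K.
Proof.
move=> Kg; rewrite memJ_norm // (subsetP (normal_norm normal_col_fixing)) //.
by rewrite groupX // (subsetP sPG).
Qed.

Let L_shift S (a : F) g : g \in L S -> g ^ (t ^+ val a) \in L [set x | (x - a)%R \in S].
Proof.
case/col_stabP=> Kg gS; apply/col_stabP; split; first exact: KJ.
move=> z; rewrite inE -[z](permKV (t ^+ val a)) permJ tX1 natrF addrK => zS.
by rewrite gS.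
Qed.

(** The vertical translations in [K] then form a normal [p]-subgroup, which lies in the Sylow
    subgroup [vtranses :&: P] of [K] and so equals it. *)
Lemma rho_normalized_kernel :
  (forall g, g \in K -> rho ^ g \in vtranses) -> K \subset 'N(vtranses :&: P).
Proof.
move=> rhoJ.
have colK : col_preserving K by move=> g /col_fixingP[_ g1] z z'; rewrite !g1.
have nVK : vtranses :&: K <| K.
  rewrite /normal subsetIr; apply/subsetP=> g Kg; rewrite inE.
  apply/subsetP=> _ /imsetP[_ /setIP[/vtransesP[f ->] Kf] ->].
  have [c [sg [_ _ _ _ JE]]] := vtrans_conj colK Kg (rhoJ g Kg).
  by rewrite in_setI -[_ \in vtranses]andbT {1}JE vtrans_in groupJ.
have -> : vtranses :&: P = vtranses :&: K.
  apply/eqP; rewrite eqEsubset -{1}col_fixing_Sylow; apply/andP; split.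
    rewrite subsetI subsetIl andbT; apply/subsetP=> g.
    by rewrite col_fixing_Sylow => /setIP[].
  rewrite subsetI subsetIl /=.
  apply: subset_trans (subsetIr K P); apply: subset_trans (pcore_sub_Hall sylK).
  apply: pcore_max nVK; exact: pgroupS (subsetIl _ _) (vtranses_pgroup hp).
exact: normal_norm nVK.
Qed.

(* Take [S] maximal among the nonempty sets of columns with [L S] nontrivial. Some
   shift of [L S] meets it trivially, hence commutes with it, and both are
   transitive on a common column, where [L S] thus consists of translations; so
   [K], which normalises [L S], acts on that column by affine maps. *)
Lemma kernel_alternative :
  (forall x, L [set x] = 1%G) \/ K \subset 'N(vtranses :&: P).
Proof.
case: (boolP [forall x : F, L [set x] == 1%G]) => [/forallP all1|].
  by left=> x; apply/eqP.
rewrite negb_forall => /existsP[j0 Lj0]; right.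
pose big S := (S != set0) && (L S != 1%G).
have big0 : big [set j0] by rewrite /big Lj0 andbT; apply/set0Pn; exists j0; rewrite inE.
have [S /andP[S0 LS] Smax] := @arg_maxnP _ [set j0] big (fun S => #|S|) big0.
have LU c : c \notin S -> L (c |: S) = 1%G.
  move=> cS; apply/eqP; apply: contraT => LcS; have := Smax (c |: S).
  rewrite /big LcS andbT cardsU1 cS add1n /= ltnn; apply.
  by apply/set0Pn; exists c; rewrite !inE eqxx.
have trL c : c \notin S -> [transitive L S, on column c | 'P].
  move=> cS; have [triv|//] := column_alternative c (normalL S).
  case/eqP: LS; apply/trivGP; rewrite -(congr_group (LU c cS)).
  by apply/subsetP=> g Lg; apply: L_U1 => // z; apply: triv.
(* Otherwise the Sylow subgroup of [L S] inside [P] fixes column [c] as well and is trivial by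
   maximality, although transitivity on that column makes [p] divide the order of [L S]. *)
have moves c : c \notin S -> exists2 f, vtrans f \in P :&: L S & f c != 0%R.
  move=> cS; have sylL := Sylow_setI_normal (normalL S) sylK.
  case: (boolP [exists f : {ffun F -> F}, (vtrans f \in P :&: L S) && (f c != 0%R)]).
    by case/existsP=> f /andP[Pf fc]; exists f.
  rewrite negb_exists => /forallP no.
  have /trivgP S1 : L S :&: (K :&: P) \subset [1 {perm Om}].
    rewrite -(congr_group (LU c cS)); apply/subsetP=> g /setIP[Lg].
    rewrite col_fixing_Sylow => /setIP[/imsetP[f _ gE] Pg]; apply: L_U1 => // z zc.
    have := no f; rewrite in_setI -gE Pg Lg /= negbK => /eqP fc.
    by rewrite gE vtransE zc fc addr0 -zc; case: (z).
  have := atrans_dvd (trL c cS); rewrite card_column // => pL.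
  have := card_Hall sylL; rewrite S1 cards1 => /esym/eqP.
  by rewrite partn_eq1 ?cardG_gt0 // p'natE // pL.
have [c cS] : exists c, c \notin S.
  apply/existsP; rewrite -negb_forall; apply: contra LS => /forallP allS.
  by rewrite (_ : S = setT) ?L_T //; apply/setP=> x; rewrite allS inE.
have [f /setIP[Pf Lf] fc] := moves c cS.
have fS x : x \in S -> f x = 0%R.
  case/col_stabP: Lf => _ /(_ (x, 0)%R) /[apply].
  by rewrite vtransE /= add0r => /pair_equal_spec[].
(* The values of [f] sum to 0, so [c] cannot be the only column outside [S]. *)
have [c' /andP[c'S cc']] : exists c', (c' \notin S) && (c' != c).
  apply/existsP; apply: contraT; rewrite negb_exists => /forallP no.
  case/eqP: fc; rewrite -(degree_sum0 hp degP n_ltp Pf) (bigD1 c) //= big1 ?addr0 //.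
  by move=> x xc; apply: fS; have := no x; rewrite xc andbT negbK.
(* The shift by [a] takes [c'] to [c], which therefore lies outside both [S] and [S']. *)
pose a := (c - c')%R; pose S' := [set x | (x - a)%R \in S].
have a0 : a != 0%R by rewrite subr_eq0 eq_sym.
have cS' : c \notin S' by rewrite inE /a opprB addrCA subrr addr0.
(* A nonempty set stable under a nonzero shift would contain every column. *)
have [k0 k0S' k0S] : exists2 k, k \in S' & k \notin S.
  apply/subsetPn; apply: contra cS => sS'; have [x xS] := set0Pn _ S0.
  have xS' k : (x + a *+ k)%R \in S.
    elim: k => [|k IH]; first by rewrite addr0.
    by rewrite (subsetP sS') // inE mulrSr addrA addrK.
  have := xS' (val ((c - x) / a)%R).
  by rewrite -mulr_natr natrF mulrC divfK // addrC subrK.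
(* Both groups are normal in [K], so the commutator fixes the columns of [S] and column [k0]; by
   maximality it is trivial. *)
have comm g g' : g \in L S -> g' \in L S' -> commute g g'.
  move=> Lg Lg'; apply/commgP.
  have Kg := subsetP (normal_sub (normalL S)) g Lg.
  have Kg' := subsetP (normal_sub (normalL S')) g' Lg'.
  have L1 : [~ g, g'] \in L S.
    rewrite /commg groupM ?groupV // memJ_norm //.
    exact: subsetP (normal_norm (normalL S)) g' Kg'.
  have L2 : [~ g, g'] \in L S'.
    rewrite commgEr groupM // memJ_norm ?groupV //.
    exact: subsetP (normal_norm (normalL S')) g Kg.
  have : [~ g, g'] \in L (k0 |: S).
    apply: L_U1 => // z zk; have /col_stabP[_] := L2; apply; by rewrite zk.
  by rewrite (LU _ k0S) => /set1P->.
have trL' y : exists2 g, g \in L S' & g (c, 0)%R = (c, y).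
  pose u := (t ^+ val a)^-1 (c, 0)%R; pose u' := (t ^+ val a)^-1 (c, y).
  have uc x : ((t ^+ val a)^-1 (c, x)).1 = c'.
    have := tX1 (val a) ((t ^+ val a)^-1 (c, x)); rewrite permKV natrF /= => cE.
    by apply: (addIr a); rewrite -cE /a addrC subrK.
  have [||g Lg gu] := @atransP2 _ _ _ _ _ (trL c' c'S) u u'; rewrite ?inE ?uc //.
  exists (g ^ (t ^+ val a)); first exact: L_shift.
  rewrite -[(c, 0)%R](permKV (t ^+ val a)) permJ -/u.
  by have -> : g u = u' by []; rewrite permKV.
(* On column [c] the conjugate [w] of [vtrans f] commutes with the transitive [L S'], hence is a
   translation there; so [g] turns steps of length [f c] into steps of a fixed length. *)
have aff1 g : g \in K -> exists v, forall y, g (c, y + 1)%R = (c, (g (c, y)).2 + v)%R.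
  move=> Kg; have [w wdef] : exists w, w = vtrans f ^ g by exists (vtrans f ^ g).
  have Lw : w \in L S by rewrite wdef memJ_norm // (subsetP (normal_norm (normalL S))).
  have Kw := subsetP (normal_sub (normalL S)) w Lw.
  pose v := (w (c, 0)%R).2.
  have w0 : w (c, 0)%R = (c, v).
    by rewrite [LHS]surjective_pairing; congr (_, _); have /col_fixingP[_ ->] := Kw.
  have wE y : w (c, y) = (c, y + v)%R.
    have [l Ll lE] := trL' y; have /permP/(_ (c, 0)%R) := comm _ _ Lw Ll.
    rewrite !permM lE w0 => <-.
    pose k := (v / f c)%R; have kE : (val k)%:R%R = k by apply: natrF.
    have fk z : z.1 = c -> (vtrans f ^+ val k) z = (c, z.2 + v)%R.
      by move=> zc; rewrite vtransX vtransE zc -mulr_natl kE /k divfK.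
    have -> : (c, v) = (vtrans f ^+ val k) (c, 0)%R by rewrite fk //= add0r.
    by rewrite -permM (comm _ _ (groupX _ Lf) Ll) permM lE fk.
  have g1 z : (g z).1 = z.1 by have /col_fixingP[_ ->] := Kg.
  have step y : g (c, y + f c)%R = (c, (g (c, y)).2 + v)%R.
    have -> : (c, y + f c)%R = vtrans f (c, y) by rewrite vtransE.
    by rewrite -permJ -wdef [g (c, y)]surjective_pairing g1 /= wE.
  pose k := (f c)^-1%R; have kE : (val k)%:R%R = k by apply: natrF.
  exists (k * v)%R => y.
  have steps m : g (c, y + m%:R * f c)%R = (c, (g (c, y)).2 + m%:R * v)%R.
    elim: m => [|m IH]; last by rewrite -natr1 !mulrDl !mul1r !addrA step IH.
    by rewrite !mul0r !addr0 [LHS]surjective_pairing g1.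
  by have := steps (val k); rewrite kE mulVf.
apply: rho_normalized_kernel => g Kg; apply/vtransP.
exists (fun x => (g (x, 1)).2 - (g (x, 0)).2)%R => z.
have gK := permKV g z; set u := g^-1 z in gK.
have g1 y : (g y).1 = y.1 by have /col_fixingP[_ ->] := Kg.
(* Conjugation by a power of [t] carries the result for column [c] to the column of [u]. *)
pose k := (c - u.1)%R; have kE : (val k)%:R%R = k by apply: natrF.
have [v vE] := aff1 _ (KJ (val k) Kg).
pose d := (\sum_(j < val k) h (u.1 + j%:R))%R.
have tE y : (t ^+ val k) (u.1, y) = (c, y + d)%R.
  by rewrite stepX /= kE /k addrC subrK.
have gE y : g (u.1, y + 1)%R = (u.1, (g (u.1, y)).2 + v)%R.
  have e := vE (y + d)%R.
  rewrite -tE -addrA [(d + 1)%R]addrC addrA -tE !permJ in e.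
  rewrite [g (u.1, y + 1)%R]surjective_pairing [g (u.1, y)]surjective_pairing !g1 /= in e *.
  rewrite !tE /= addrAC in e; have /pair_equal_spec[_ /addIr->] := e.
  by [].
have v_eq : v = ((g (u.1, 1)).2 - (g (u.1, 0)).2)%R.
  by have := gE 0%R; rewrite add0r => ->; rewrite /= addrAC subrr add0r.
rewrite -gK permJ vtransE gE g1 -v_eq; congr (_, _).
by congr ((g _).2 + _)%R; case: (u).
Qed.

Section Nonstandard.
Hypothesis nonstandard : (\sum_x h x != 0)%R \/ n <> 1%N /\ n <> p.-1.
Local Notation Q := (vtranses :&: P).

Let sPNQ : P \subset 'N(Q).
Proof.
by rewrite -col_fixing_Sylow setIC; apply: normal_norm (normalGI sPG normal_col_fixing).
Qed.

Let sQK : Q \subset K.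
Proof. by rewrite -col_fixing_Sylow subsetIl. Qed.

(* Here [n = 1] and [sum_x h x <> 0], so that [P] is cyclic and normal in [N_G(Q)];
   hence [N_K(Q)] centralises [t ^+ p], a generator of [Q], and equals [Q]. *)
Lemma faithful_kernel : (forall x, L [set x] = 1%G) -> K \subset 'N(Q).
Proof.
move=> faith.
(* For larger [n] the translation by ['X] would lie in [P] and fix column 0 pointwise. *)
have n1 : n = 1%N.
  apply/eqP; rewrite eqn_leq; have /andP[-> _] := n_bounds; rewrite andbT leqNgt.
  apply/negP=> n2; have PX : vtrans (horner ('X : {poly F})) \in P.
    by rewrite degP interp_horner // size_polyX // prime_gt1.
  have : vtrans (horner ('X : {poly F})) \in L [set 0%R].
    apply/col_stabP; split; first by rewrite (subsetP sQK) // in_setI vtrans_in PX.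
    move=> z /set1P z0.
    by rewrite vtransE hornerX {2}z0 addr0; case: (z).
  rewrite (congr_group (faith 0%R)) => /set1P/permP/(_ (1, 0)%R).
  by rewrite perm1 vtransE hornerX /= add0r => /pair_equal_spec[_ /eqP]; rewrite oner_eq0.
have s0 : (\sum_x h x != 0)%R by case: nonstandard => // -[].
have Qrho w : w \in Q -> exists k, w = rho ^+ k.
  case/setIP=> /vtransesP[f ->]; rewrite degP n1 => /size1_polyC fE.
  exists (val (interp f)`_0%N); rewrite vtransX; apply: vtrans_eq => x.
  by rewrite -(horner_interp hp f) {1}fE hornerC natrF.
have QE : Q = <[rho]>.
  apply/eqP; rewrite eqEsubset cycle_subG in_setI vtrans_in Prho /= andbT.
  by apply/subsetP=> w /Qrho[k ->]; apply: mem_cycle.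
have oQ : #|Q| = p.
  rewrite QE -orderE; apply: nt_prime_order => //; first exact: order_vtrans.
  apply/eqP=> /permP/(_ (0, 0)%R); rewrite perm1 vtransE /= => /pair_equal_spec[_ /eqP].
  by rewrite add0r oner_eq0.
pose N := 'N_G(Q)%G.
have sPN : P \subset N by rewrite subsetI sPG.
have sNG : N \subset G by apply: subsetIl.
have sylN : p.-Sylow(N) P := pHall_subl sPN sNG sylP.
have colN : col_preserving N by move=> g Ng; apply: colG; apply: subsetP Ng.
have nQN : N \subset 'N(Q) by apply: subsetIr.
have nPN : P <| N.
  exact: (normal_case hp sylN trP colN sPW Ph n_bounds degP nonstandard nQN).
have nQK : 'N_K(Q) = Q.
  apply/eqP; rewrite eqEsubset; apply/andP; split; last first.
    by rewrite [in X in _ \subset X]setIC subsetI sQK QE normG.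
  apply/subsetP=> g /setIP[Kg NQg]; have /col_fixingP[Gg g1] := Kg.
  have Ng : g \in N by rewrite inE Gg.
  have Ptg : t ^ g \in P by rewrite memJ_norm // (subsetP (normal_norm nPN)).
  have [k wE] : exists k, t^-1 * t ^ g = rho ^+ k.
    apply: Qrho; rewrite -col_fixing_Sylow; apply/setIP; split; last first.
      by rewrite groupM ?groupV.
    rewrite -[_ * _]/[~ t, g] commgEr groupM // memJ_norm ?groupV //.
    by rewrite (subsetP (normal_norm normal_col_fixing)) // (subsetP sPG).
  have rhot : commute rho t.
    by apply/permP=> z; rewrite !(permM, vtransE, htransE) /= addrAC.
  (* [t ^ g] is [t] times a power of [rho], which commutes with [t] and has trivial [p]-th power. *)
  have tp : (t ^+ p) ^ g = t ^+ p.
    rewrite conjXg -[t ^ g](mulKVg t) wE expgMn; last by apply: commuteX; apply: commute_sym.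
    by rewrite -expgM mulnC expgM order_vtrans // expg1n mulg1.
  have rhoE : rho = (t ^+ p) ^+ val ((\sum_x h x)^-1)%R.
    rewrite step_p // vtransX; apply: vtrans_eq => x.
    by rewrite -mulr_natr natrF divff.
  have rhog : commute g rho.
    by apply/esym/commgP/conjg_fixP; rewrite rhoE conjXg tp.
  apply: (subsetP _ g (_ : g \in vtranses :&: N)).
    rewrite subsetI subsetIl /=.
    exact: (vtranses_sub_Sylow hp sylN colN n_bounds degP nQN).
  rewrite in_setI Ng andbT; apply/vtransP; exists (fun x => (g (x, 0)%R).2) => z.
  have zE : z = (rho ^+ val z.2) (z.1, 0)%R.
    by rewrite vtransX vtransE /= add0r natrF; case: (z).
  rewrite {1}zE -permM -(commuteX _ rhog) permM vtransX vtransE /= g1 natrF.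
  by rewrite addrC.
have KQ : K = <[rho]> :> {set _}.
  apply: (@self_normalizing_regular p _ (column 0%R) K <[rho]>%G hp) => //.
  - exact: card_column.
  - by rewrite /= -QE.
  - by rewrite /= -QE.
  - by rewrite /= -QE.
  - move=> g Kg g0; apply/set1P; rewrite -(congr_group (faith 0%R)).
    by apply/col_stabP; split=> // z /set1P z0; apply: g0; rewrite inE z0.
  move=> g z; rewrite /= -QE => /setIP[/vtransesP[f gE] Pg] _ gz.
  have [k gk] : exists k, g = rho ^+ k by apply: Qrho; rewrite in_setI Pg gE vtrans_in.
  move: gz; rewrite gk vtransX vtransE => /(congr1 snd)/= /(canRL (addKr _)).
  rewrite addNr => k0; rewrite -vtrans0; apply: vtrans_eq => x; exact: k0.
by rewrite QE KQ normG.
Qed.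

(** A normal Sylow subgroup of [K] is characteristic in [K], hence normal in [G]. *)
Lemma imprimitive_normal : P <| G.
Proof.
have nK : K \subset 'N(Q) by case: kernel_alternative => // /faithful_kernel.
have nQG : G \subset 'N(Q).
  have nQK : K :&: P <| K by rewrite /normal subsetIl col_fixing_Sylow.
  rewrite -col_fixing_Sylow; apply: normal_norm.
  rewrite -(normal_Hall_pcore sylK nQK); apply: char_normal_trans normal_col_fixing.
  exact: pcore_char.
exact: (normal_case hp sylP trP colG sPW Ph n_bounds degP nonstandard nQG).
Qed.

End Nonstandard.

End Kernel.

(** * Coordinates *)

Section PlaneTheorem.
Variable p : nat.
Hypothesis hp : prime p.
Local Notation F := 'F_p.
Local Notation Om := (Zp2 (pdiv p)).
Local Notation wreath := (wreath p).

(** By Legendre's formula the exponent of [p] in the factorial of [p ^ 2] is [p + 1]. *)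
Lemma wreath_Sylow : p.-Sylow([set: {perm Om}]) wreath.
Proof.
rewrite pHallE subsetT card_wreath //= p_part; apply/eqP; congr (_ ^ _)%N.
have -> : #|[set: {perm Om}]| = ((p ^ 2)`!)%N.
  rewrite -(card_Om hp) -cardsT -card_perm; apply: eq_card => g; rewrite !inE.
  by apply/esym/subsetP=> z _; rewrite inE.
have p1 : (1 < p)%N := prime_gt1 hp.
have p2 : (2 < (p ^ 2).+1)%N by rewrite ltnS (leq_trans p1) // -[X in (X <= _)%N]expn1 leq_exp2l.
rewrite logn_fact // big_ltn ?(ltn_trans _ p2) // big_ltn // big_nat big1 => [|k].
  by rewrite expn1 -mulnn mulKn ?prime_gt0 // mulnn divnn expn_gt0 prime_gt0 //= addn0 addn1.
case/andP=> k3 _; apply: divn_small; by rewrite ltn_exp2l.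
Qed.

Lemma plane_Sylow_alternative (G P : {group {perm Om}}) :
    p.-Sylow(G) P -> [transitive G, on setT | 'P] -> P \subset wreath ->
    [primitive G, on setT | 'P] \/ col_preserving G ->
  [\/ doubly_transitive G, P <| G
    | [\/ perm_equivalent P (Zp_times_Zp p), perm_equivalent P (P_pred_p' p)
        | perm_equivalent P (Zp_wr_Zp p)]].
Proof.
move=> sylP trG sPW primcol.
have trP := Sylow_transitive hp (card_Om hp) trG sylP.
have sPG := pHall_sub sylP.
have [h Ph] := transitive_step sPW trP.
have [n /andP[n0 np] degP] := transitive_degree hp sPW trP.
have atp (X : forall q, {group {perm Zp2 q}}) :
    perm_equivalent P (X (pdiv p)) -> perm_equivalent P (X p).
  by have: forall m, m = pdiv p -> perm_equivalent P (X (pdiv p)) ->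
    perm_equivalent P (X m) by [move=> m ->]; apply; rewrite pdiv_id.
have [nE|n_ne] := eqVneq n p.
  apply: Or33; apply: Or33; apply: atp.
  exact: (degree_full_equivalent hp sPW Ph degP nE).
have {np n_ne} np : (n < p)%N by rewrite ltn_neqAle n_ne.
have [/andP[s0 n_std]|nonstd] := boolP ((\sum_x h x == 0)%R && ((n == 1)%N || (n == p.-1))).
  apply: Or33; case/orP: n_std => /eqP nE; [apply: Or31 | apply: Or32].
    by apply: atp; apply: (degree1_equivalent hp sPW Ph degP (eqP s0) nE).
  by apply: atp; apply: (degree_pred_equivalent hp sPW Ph degP (eqP s0) nE).
have {}nonstd : (\sum_x h x != 0)%R \/ n <> 1%N /\ n <> p.-1.
  move: nonstd; rewrite negb_and negb_or => /orP[|/andP[/eqP ? /eqP ?]]; first by left.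
  by right.
have n_bounds : (0 < n < p)%N by rewrite n0.
case: primcol => [primG|colG]; last first.
  apply: Or32; exact: (imprimitive_normal hp sylP trP colG sPW Ph n_bounds degP nonstd).
apply: Or31; have [s0|s0] := eqVneq (\sum_x h x)%R 0%R; last first.
  exact: (primitive_nonsplit hp s0 (subsetP sPG _ Ph) primG).
have n1 : (1 < n)%N.
  rewrite ltn_neqAle n0 eq_sym andbT; case: nonstd => [|[/eqP//]].
  by rewrite s0 eqxx.
exact: (primitive_degree_ge2 hp sPG n1 degP primG).
Qed.

End PlaneTheorem.

(** * Transport of permutation groups along a bijection *)

Section Transport.
Variables (T U : finType) (f : T -> U) (f' : U -> T).
Hypotheses (fK : cancel f f') (f'K : cancel f' f).

Lemma transport_inj (t : {perm T}) : injective (f \o t \o f').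
Proof. by apply: inj_comp (can_inj f'K); apply: inj_comp (can_inj fK) perm_inj. Qed.

Definition transport (t : {perm T}) : {perm U} := perm (@transport_inj t).

Lemma transportE t x : transport t (f x) = f (t x).
Proof. by rewrite permE /= fK. Qed.

Lemma transportM : {in setT &, {morph transport : s t / s * t}}.
Proof. by move=> s t _ _; apply/permP=> x; rewrite -[x]f'K permM !transportE permM. Qed.
Canonical transport_morphism := Morphism transportM.

Lemma injm_transport : 'injm transport.
Proof.
apply/injmP=> s t _ _ st; apply/permP=> x; apply: (can_inj fK).
by rewrite -!transportE st.
Qed.

Lemma transport_mem (A : {group {perm T}}) t : (transport t \in transport @* A) = (t \in A).
Proof.
apply/idP/idP=> [/morphimP[s _ As]|At]; last by rewrite mem_morphim ?inE.
by move/(injmP injm_transport) => ->; rewrite ?inE.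
Qed.

Lemma transport_transitive (G : {group {perm T}}) :
  [transitive G, on setT | 'P] -> [transitive (transport @* G), on setT | 'P].
Proof.
case/imsetP=> x _ xE; apply/imsetP; exists (f x) => //; apply/setP=> y.
rewrite inE; apply/esym/imsetP; have : f' y \in [set: T] by [].
rewrite xE => /imsetP[g Gg e]; exists (transport g); first by rewrite transport_mem.
by rewrite /= /aperm transportE -[y]f'K e.
Qed.

Lemma transport_primitive (G : {group {perm T}}) :
  [primitive G, on setT | 'P] -> [primitive (transport @* G), on setT | 'P].
Proof.
move=> primG; have trG : [transitive G, on setT | 'P] by case/andP: primG.
have [x _ _] := imsetP trG.
rewrite (trans_prim_astab (in_setT (f x)) (transport_transitive trG)).
have -> : 'C_(transport @* G)[f x | 'P] = transport @* 'C_G[x | 'P].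
  apply/setP=> g; apply/setIP/morphimP=> [[/morphimP[t _ Gt ->] tx]|[t _ /setIP[Gt tx] ->]].
    have {}tx : transport t (f x) = f x := astab1P tx.
    exists t => //; apply/setIP; split=> //; apply: (introT astab1P); apply: (can_inj fK).
    by rewrite -transportE.
  have {}tx : t x = x := astab1P tx.
  split; first by rewrite mem_morphim ?inE.
  by apply/astab1P; rewrite /= /aperm transportE tx.
by rewrite injm_maximal_eq ?subsetT ?injm_transport // -(trans_prim_astab (in_setT x) trG).
Qed.

Lemma transport_doubly_transitive (G : {group {perm T}}) :
  doubly_transitive (transport @* G) -> doubly_transitive G.
Proof.
move=> tr2 x y x' y' xy xy'.
have fI := can_inj fK.
have /same_orbitalP[g [/morphimP[t _ Gt ->]]] : same_orbital (transport @* G) (f x) (f y) (f x') (f y').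
  by apply: tr2; rewrite (inj_eq fI).
rewrite !transportE => /fI tx /fI ty.
by apply/same_orbitalP; exists t.
Qed.

Lemma transport_equivalent (W : finType) (A : {group {perm T}}) (B : {set {perm W}}) :
  perm_equivalent (transport @* A) B -> perm_equivalent A B.
Proof.
case=> k kB kE; exists (k \o f); first by apply: bij_comp => //; exists f'.
move=> s; split=> [/kE[_ /morphimP[t _ At ->] e]|[t At e]].
  by exists t => // x; rewrite /= e transportE.
apply/kE; exists (transport t); first by rewrite mem_morphim ?inE.
by move=> x; rewrite -[x]f'K transportE -[RHS]e.
Qed.

End Transport.

(** * Coordinates adapted to the blocks and to the Sylow subgroup *)

Section Coordinates.
Variable p : nat.
Hypothesis hp : prime p.
Local Notation F := 'F_p.
Local Notation Om := (Zp2 (pdiv p)).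
Local Notation wreath := (wreath p).
Variables (T : finType) (G P : {group {perm T}}).
Hypotheses (oT : #|T| = (p ^ 2)%N) (trG : [transitive G, on [set: T] | 'P]).

Definition col_compatible (f : T -> Om) := forall t, t \in G ->
  forall x y, (f x).1 = (f y).1 -> (f (t x)).1 = (f (t y)).1.

Lemma natr_lt_inj i j : (i < p)%N -> (j < p)%N -> i%:R%R = j%:R%R :> F -> i = j.
Proof.
by move=> ip jp /(congr1 val); rewrite /= !val_Fp_nat // !modn_small.
Qed.

(** In degree [p ^ 2] a nontrivial block system has [p] blocks of [p] points; the coordinates are
    the number of the block and the position within it. *)
Lemma imprimitive_coordinates Q : imprimitivity_system G [set: T] 'P Q ->
  exists f : T -> Om, bijective f /\ col_compatible f.
Proof.
case/and3P=> partQ actQ /andP[Q1 QT].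
have [/eqP covQ tiQ Q0] := and3P partQ.
have memQ x : x \in pblock Q x by rewrite mem_pblock covQ.
have inQ x : pblock Q x \in Q by rewrite pblock_mem ?covQ.
have actB t B : t \in G -> B \in Q -> t @: B \in Q.
  move=> Gt QB; have e : ('P^*)%act B t \in Q by rewrite (actsP actQ).
  exact: e.
have pbJ t x : t \in G -> t @: pblock Q x = pblock Q (t x).
  move=> Gt; apply/esym/(def_pblock tiQ (actB _ _ Gt (inQ x))).
  by apply: imset_f; apply: memQ.
have unif B C : B \in Q -> C \in Q -> #|B| = #|C|.
  move=> QB QC.
  have [x Bx] : exists x, x \in B by apply/set0Pn; apply: contraNneq Q0 => <-.
  have [y Cy] : exists y, y \in C by apply/set0Pn; apply: contraNneq Q0 => <-.
  have [t Gt txy] := transP x y trG.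
  rewrite -(def_pblock tiQ QB Bx) -(def_pblock tiQ QC Cy) -txy -pbJ //.
  by rewrite card_imset //; apply: perm_inj.
have [x0 _ _] := imsetP trG.
have oTQ := card_uniform_partition (fun B QB => unif B _ QB (inQ x0)) partQ.
rewrite cardsT oT in oTQ QT.
have oQ : #|Q| = p.
  have /(dvdn_pfactor _ _ hp)[[|[|[|m]]] // _ e] : #|Q| %| p ^ 2 by rewrite oTQ dvdn_mulr.
    by rewrite e in Q1.
  by rewrite e ltnn in QT.
have oB x : #|pblock Q x| = p.
  have := unif _ _ (inQ x) (inQ x0) => ->.
  by apply/eqP; rewrite -(eqn_pmul2l (prime_gt0 hp)) -{1}oQ -oTQ mulnn.
pose i x := index (pblock Q x) (enum Q); pose j x := index x (enum (pblock Q x)).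
have ip x : (i x < p)%N by rewrite -oQ cardE index_mem mem_enum.
have jp x : (j x < p)%N by rewrite -(oB x) cardE index_mem mem_enum.
have iI x y : i x = i y -> pblock Q x = pblock Q y.
  by move=> e; apply: (index_inj set0 (s := enum Q)) e; rewrite mem_enum.
exists (fun x => ((i x)%:R, (j x)%:R)%R); split.
  apply: inj_card_bij; last by rewrite card_Om // oT.
  move=> x y /pair_equal_spec[/(natr_lt_inj (ip x) (ip y))/iI e /(natr_lt_inj (jp x) (jp y))].
  rewrite /j e => e'; apply: (index_inj x (s := enum (pblock Q y))) e'; rewrite mem_enum //.
  by rewrite -e.
move=> t Gt x y /= /(natr_lt_inj (ip x) (ip y))/iI e.
by rewrite /i -!pbJ // e.
Qed.

Lemma initial_coordinates : exists f : T -> Om, bijective f /\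
  ([primitive G, on [set: T] | 'P] \/ col_compatible f).
Proof.
have [primG|] := boolP [primitive G, on [set: T] | 'P].
  have e : #|T| = #|Om| by rewrite oT card_Om.
  exists (fun x => enum_val (cast_ord e (enum_rank x))); split; last by left.
  exists (fun z => enum_val (cast_ord (esym e) (enum_rank z))) => x.
    by rewrite enum_valK cast_ordK enum_rankK.
  by rewrite enum_valK cast_ordKV enum_rankK.
rewrite /primitive trG negbK => /existsP[Q /imprimitive_coordinates[f [fB fG]]].
by exists f; split=> //; right.
Qed.

Hypothesis sylP : p.-Sylow(G) P.

Lemma adapted_coordinates : exists (f : T -> Om) (f' : Om -> T)
    (fK : cancel f f') (f'K : cancel f' f),
  transport fK f'K @* P \subset wreath /\
  ([primitive G, on [set: T] | 'P] \/ col_preserving (transport fK f'K @* G)).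
Proof.
have [f [[f' fK f'K] fG]] := initial_coordinates.
(* Sylow's theorem is applied inside [B], so that conjugating [P] into [wreath] keeps the columns as
   blocks in the imprimitive case. *)
pose B : {set {perm Om}} := if [primitive G, on [set: T] | 'P] then setT else
  [set b : {perm Om} | [forall z : Om, forall z' : Om, (z.1 == z'.1) ==> ((b z).1 == (b z').1)]].
have BG : group_set B.
  rewrite /B; case: ifP => _; first exact: (valP [set: {perm Om}]%G).
  apply/group_setP; split.
    by rewrite inE; apply/forallP=> z; apply/forallP=> z'; rewrite !perm1; apply/implyP.
  move=> b c; rewrite !inE => /forallP Bb /forallP Bc.
  apply/forallP=> z; apply/forallP=> z'; apply/implyP=> zz'; rewrite !permM.
  have /forallP/(_ z')/implyP/(_ zz') e := Bb z.
  by have /forallP/(_ (b z'))/implyP := Bc (b z); apply.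
have sWB : wreath \subset group BG.
  rewrite /= /B; case: ifP => _; first exact: subsetT.
  apply/subsetP=> w /wreathP[a [h hE]]; rewrite inE.
  apply/forallP=> z; apply/forallP=> z'; apply/implyP=> /eqP zz'.
  by rewrite !hE /= zz'.
have sGB : transport fK f'K @* G \subset group BG.
  rewrite /= /B; case: ifP => primG; first exact: subsetT.
  case: fG => [|fG]; first by rewrite primG.
  apply/subsetP=> _ /morphimP[t _ Gt ->]; rewrite inE.
  apply/forallP=> z; apply/forallP=> z'; apply/implyP=> /eqP zz'.
  rewrite -[z]f'K -[z']f'K !transportE; apply/eqP/fG => //.
  by rewrite !f'K.
have sylW : p.-Sylow(group BG) wreath := pHall_subl sWB (subsetT _) (wreath_Sylow hp).
have pP : p.-group (transport fK f'K @* P) := morphim_pgroup _ (pHall_pgroup sylP).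
have sPB : transport fK f'K @* P \subset group BG.
  by apply: subset_trans sGB; apply: morphimS; apply: pHall_sub sylP.
have [b Bb sPbW] := Sylow_Jsub sylW sPB pP.
have bfK : cancel (b \o f) (f' \o b^-1) by move=> x; rewrite /= permK fK.
have bfK' : cancel (f' \o b^-1) (b \o f) by move=> x; rewrite /= f'K permKV.
have tE t : transport bfK bfK' t = transport fK f'K t ^ b.
  by apply/permP=> x; rewrite -[x]bfK' transportE /= permJ transportE.
exists (b \o f), (f' \o b^-1), bfK, bfK'; split.
  apply: subset_trans sPbW; apply/subsetP=> _ /morphimP[t _ Pt ->].
  by rewrite /= tE memJ_conjg mem_morphim ?inE.
have [primG|nprimG] := boolP [primitive G, on [set: T] | 'P]; first by left.
right=> _ /morphimP[t _ Gt ->] z z' zz'.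
have : transport bfK bfK' t \in group BG.
  by rewrite tE groupJ // (subsetP sGB) // mem_morphim ?inE.
rewrite /= /B (negPf nprimG) inE => /forallP/(_ z)/forallP/(_ z')/implyP.
by rewrite zz' => /(_ (eqxx _))/eqP.
Qed.

End Coordinates.

Theorem theorem3 (p : nat) (hp : prime p)
    (T : finType) (hT : #|T| = (p ^ 2)%N)
    (G P : {group {perm T}})
    (hG : [transitive G, on [set: T] | 'P])
    (hP : p.-Sylow(G) P) :
  [\/ [transitive^2 G, on [set: T] | 'P],
      P <| G
    | [\/ perm_equivalent P (Zp_times_Zp p),
          perm_equivalent P (P_pred_p' p)
        | perm_equivalent P (Zp_wr_Zp p)]].
Proof.
have [f [f' [fK [f'K [sPW primcol]]]]] := adapted_coordinates hp hT hG hP.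
have sylfP : p.-Sylow(transport fK f'K @* G) (transport fK f'K @* P).
  by apply: morphim_pSylow hP; apply: subsetT.
have primcol' : [primitive (transport fK f'K @* G), on setT | 'P] \/
    col_preserving (transport fK f'K @* G).
  by case: primcol => [/(transport_primitive fK f'K)|]; [left | right].
have [tr2|nPG|eqP] := plane_Sylow_alternative hp sylfP (transport_transitive fK f'K hG) sPW primcol'.
- apply: Or31; apply: doubly_transitiveW (transport_doubly_transitive tr2).
  by rewrite hT (ltn_trans (prime_gt1 hp)) // -{1}[p]expn1 ltn_exp2l // prime_gt1.
- by apply: Or32; rewrite -(injm_normal (injm_transport fK f'K)) ?subsetT.
apply: Or33; case: eqP => /transport_equivalent eqP;
  [exact: Or31 | exact: Or32 | exact: Or33].
Qed.
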